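(* Let $\mathcal{U}$ be a nonempty separable subset of $\mathfrak{C}(\mathbb{E})$, equipped with the induced Pompeiu-Hausdorff metric $h$. Let $\{X_n\}_{n=1}^{+\infty}$ be a sequence of independent identically distributed random sets $X_n:\Omega\to\mathcal{U}$ with expectation $E(X_n)=C$ for every $n\in\mathbb{N}$, where $C\in\mathfrak{C}_c(\mathbb{E})$. Suppose furthermore that, for almost every $\omega\in\Omega$, there is a nonempty compact (with respect to $h$) subset $\mathcal{Z}(\omega)$ of $\mathcal{U}$ such that $\{X_n(\omega)\}_{n=1}^{+\infty}\subset\mathcal{Z}(\omega)$. Then $$\frac{\overline{X_1(\omega)+\dots+X_n(\omega)}}{n}\xrightarrow{F} C\quad\text{as } n\to+\infty,\ \text{a.s. on }\Omega.$$ If, in addition, $C$ is compact, then $$\frac{\overline{X_1(\omega)+\dots+X_n(\omega)}}{n}\xrightarrow{h} C\quad\text{as } n\to+\infty,\ \text{a.s. on }\Omega.$$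
   Context: $\mathbb{E}$ is an arbitrary (not necessarily separable) real Banach space; $(\Omega,\mathscr{A},P)$ is a complete probability space without atoms. $\mathfrak{C}(\mathbb{E})$ (resp. $\mathfrak{C}_c(\mathbb{E})$) is the space of nonempty closed bounded (resp. nonempty closed convex bounded) subsets of $\mathbb{E}$. For nonempty bounded $X,Y\subset\mathbb{E}$: $d(x,Y)=\inf_{y\in Y}\|x-y\|$, $e(X,Y)=\sup_{x\in X}d(x,Y)$, $h(X,Y)=\max\{e(X,Y),e(Y,X)\}$ (Pompeiu-Hausdorff metric), $\|X\|=\sup_{x\in X}\|x\|$. Sums and scalar multiples of sets are elementwise; the bar denotes norm closure. Convergence: $X_n\xrightarrow{h}X$ means $h(X_n,X)\to0$. $X_n\xrightarrow{F}X$ (Fisher convergence) means $\lim_n e(X_n,X)=0$ and $\lim_n d(z,X_n)=0$ for every $z\in X$. Random sets: a map $G:\Omega\to\mathfrak{C}(\mathbb{E})$ is countably-valued if $G(\omega)=\sum_{i=1}^{\infty}A_i\chi_{\Omega_i}(\omega)$ (i.e. $G=A_i$ on $\Omega_i$) for some $A_i\in\mathfrak{C}(\mathbb{E})$ and some measurable partition $\{\Omega_i\}_{i=1}^\infty$ of $\Omega$. A map $F:\Omega\to\mathfrak{C}(\mathbb{E})$ is strongly measurable if there are countably-valued maps $G_n:\Omega\to\mathfrak{C}(\mathbb{E})$ with $\operatorname{ess\,sup}_{\omega}h(G_n(\omega),F(\omega))\to0$. A random set is a strongly measurable $F:\Omega\to\mathfrak{C}(\mathbb{E})$ with $\int_\Omega\|F(\omega)\|\,dP<+\infty$;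 a random set $X:\Omega\to\mathcal{U}$ is one with values in $\mathcal{U}$. Independence and identical distribution are in the usual sense for random elements of a metric space (here $(\mathcal{U},h)$). Expectation: a map $f:\Omega\to\mathbb{E}$ is measurable if it is a uniform a.s. limit (in the $\operatorname{ess\,sup}$ norm) of countably-valued maps $\Omega\to\mathbb{E}$; $\mathrm{S}^1_F$ is the set of measurable $f:\Omega\to\mathbb{E}$ with $f(\omega)\in F(\omega)$ for $\omega\in\Omega$. The expectation of a random set $F$ is its Aumann integral $E(F)=\overline{\{\int_\Omega f\,dP : f\in \mathrm{S}^1_F\}}$ (Bochner integrals). *)

(* Defs.v *)
From HB Require Import structures.
From mathcomp Require Import all_boot all_order all_algebra.
From mathcomp Require Import finmap.
From mathcomp Require Import all_classical all_reals all_analysis ess_sup_inf.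

Set Implicit Arguments.
Unset Strict Implicit.
Unset Printing Implicit Defensive.

Import Order.TTheory GRing.Theory Num.Theory.
Import numFieldNormedType.Exports.

Local Open Scope classical_set_scope.
Local Open Scope ring_scope.

(* Distances, excesses and norms of sets are extended reals, so that infima and
   suprema need no side condition; they are finite on nonempty bounded sets. *)
Section set_distances.
Context {R : realType} {E : normedModType R}.
Implicit Types (x : E) (X Y : set E).
Local Open Scope ereal_scope.

Definition set_dist x Y : \bar R := ereal_inf [set `|x - y|%:E | y in Y].

Definition excess X Y : \bar R := ereal_sup [set set_dist x Y | x in X].

Definition hausdorff X Y : \bar R := maxe (excess X Y) (excess Y X).

Definition set_norm X : \bar R := ereal_sup [set `|x|%:E | x in X].

Definition hausdorff_cvg (A : nat -> set E) (C : set E) : Prop :=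
  hausdorff (A n) C @[n --> \oo] --> 0.

Definition fisher_cvg (A : nat -> set E) (C : set E) : Prop :=
  excess (A n) C @[n --> \oo] --> 0 /\
  forall z, C z -> set_dist z (A n) @[n --> \oo] --> 0.

End set_distances.

Definition set_add {V : zmodType} (A B : set V) : set V :=
  [set x + y | x in A & y in B].

Definition set_scale {R : pzRingType} {V : lmodType R} (a : R) (A : set V)
  : set V := [set a *: x | x in A].

(* Sequences are indexed from 0: [A i] is the (i+1)-st term, so this is the
   closure of A_1 + ... + A_n, divided by n. *)
Definition set_average {R : realType} {E : normedModType R}
    (A : nat -> set E) (n : nat) : set E :=
  set_scale n%:R^-1 (closure (\big[set_add/[set 0]]_(i < n) A i)).

(* The space of nonempty closed bounded subsets of E. *)
Record cbset {R : realType} (E : normedModType R) := CBSet {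
  cbset_set :> set E ;
  cbset_neq0 : cbset_set !=set0 ;
  cbset_closed : closed cbset_set ;
  cbset_bounded : bounded_set cbset_set }.

(* The Pompeiu-Hausdorff metric makes [cbset E] a [metricType], whose topology
   is the one used below for compactness, separability and Borel sets. *)
Section cbset_metric.
Context {R : realType} {E : normedModType R}.
Implicit Types (A B C : cbset E).
Local Open Scope ereal_scope.

HB.instance Definition _ := gen_eqMixin (cbset E).
HB.instance Definition _ := gen_choiceMixin (cbset E).

Lemma cbset_eq A B : (A : set E) = B -> A = B.
Proof.
case: A B => [A a1 a2 a3] [B b1 b2 b3] /= AB; subst B.
by congr CBSet; exact: Prop_irrelevance.
Qed.

Lemma set_dist_ge0 (x : E) (Y : set E) : 0 <= set_dist x Y.
Proof. by apply: le_ereal_inf_tmp => _ [y Yy <-]; rewrite lee_fin. Qed.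

Lemma set_dist_le (x y : E) (Y : set E) : Y y -> set_dist x Y <= `|x - y|%:E.
Proof. by move=> Yy; apply: ereal_inf_lbound; exists y. Qed.

Lemma excess_ge (x : E) (X Y : set E) : X x -> set_dist x Y <= excess X Y.
Proof. by move=> Xx; apply: ereal_sup_ubound; exists x. Qed.

Lemma excess_ge0 A B : 0 <= excess A B.
Proof.
by have [x Ax] := cbset_neq0 A; apply: le_trans (excess_ge _ Ax); exact: set_dist_ge0.
Qed.

Lemma excess_lty A B : excess A B < +oo.
Proof.
have [b Bb] := cbset_neq0 B.
have /pinfty_ex_gt0[M M0 AM] := cbset_bounded A.
apply: (@le_lt_trans _ _ (M + `|b|)%:E); last exact: ltry.
apply: ge_ereal_sup => _ [x Ax <-]; apply: le_trans (set_dist_le _ Bb) _.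
by rewrite lee_fin (le_trans (ler_normB _ _))// lerD2r; exact: AM.
Qed.

Lemma hausdorff_fin_num A B : hausdorff A B \is a fin_num.
Proof.
rewrite ge0_fin_numE ?/hausdorff ?gt_max ?le_max ?excess_ge0//.
by rewrite !excess_lty.
Qed.

Lemma set_dist_triangle (x y : E) (Y : set E) :
  set_dist x Y <= `|x - y|%:E + set_dist y Y.
Proof.
rewrite -leeBlDl//; apply: le_ereal_inf_tmp => _ [z Yz <-].
rewrite leeBlDl// -EFinD (le_trans (set_dist_le _ Yz))// lee_fin.
exact: ler_distD.
Qed.

Lemma excess_triangle A B C : excess A C <= excess A B + excess B C.
Proof.
apply: ge_ereal_sup => _ [x Ax <-].
apply: le_trans (leeD2r _ (excess_ge B Ax)).
have fBC : excess B C \is a fin_num by rewrite ge0_fin_numE ?excess_ge0 ?excess_lty.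
rewrite -leeBlDr//; apply: le_ereal_inf_tmp => _ [y By <-].
rewrite leeBlDr// (le_trans (set_dist_triangle _ y _))//.
by rewrite leeD2l// excess_ge.
Qed.

Lemma excess0_subset A B : excess A B = 0 -> A `<=` B.
Proof.
move=> AB0 x Ax.
suff : closure B x by rewrite -(closure_id _).1//; exact: cbset_closed.
move=> V /nbhs_normP[e /= e0 eV].
have : set_dist x B < e%:E.
  by apply: le_lt_trans (excess_ge _ Ax) _; rewrite AB0 lte_fin.
move=> /ereal_inf_lt[_ [y By <-]]; rewrite lte_fin => xy.
by exists y; split => //; exact: eV.
Qed.

Let hdist A B : R := fine (hausdorff A B).

Let hdistxx A : hdist A A = 0%R.
Proof.
rewrite /hdist /hausdorff maxxx; suff -> : excess A A = 0 by [].
apply/eqP; rewrite eq_le excess_ge0 andbT; apply: ge_ereal_sup => _ [x Ax <-].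
by rewrite (le_trans (set_dist_le _ Ax))// subrr normr0.
Qed.

Let hdist_positivity A B : hdist A B = 0%R -> A = B.
Proof.
move=> AB0; have : hausdorff A B <= 0.
  by rewrite -(fineK (hausdorff_fin_num A B)) -/(hdist A B) AB0.
rewrite /hausdorff ge_max => /andP[AB BA].
by apply/cbset_eq/seteqP; split; apply: excess0_subset;
  apply/eqP; rewrite eq_le excess_ge0 andbT.
Qed.

Let hdist_sym A B : hdist A B = hdist B A.
Proof. by rewrite /hdist /hausdorff maxC. Qed.

Let hdist_triangle B A C : (hdist A C <= hdist A B + hdist B C)%R.
Proof.
rewrite -lee_fin EFinD !fineK ?hausdorff_fin_num// {1}/hausdorff ge_max.
apply/andP; split; first apply: le_trans (excess_triangle A B C) _.
  by apply: leeD; rewrite le_max lexx.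
by apply: le_trans (excess_triangle C B A) _; rewrite addeC;
  apply: leeD; rewrite le_max lexx orbT.
Qed.

HB.instance Definition _ := isMetric.Build R (cbset E)
  hdistxx hdist_positivity hdist_sym hdist_triangle.

Lemma cbset_mdistE A B : (mdist A B)%:E = hausdorff A B.
Proof. by rewrite fineK// hausdorff_fin_num. Qed.

End cbset_metric.

Definition separable_set {T : topologicalType} (U : set T) : Prop :=
  exists D : set T, [/\ countable D, D `<=` U & U `<=` closure D].

(* Borel sets of the subspace [U], whose open sets are the traces on [U]. *)
Definition borel_on {T : topologicalType} (U : set T) : set_system T :=
  <<s U, [set V `&` U | V in open] >>.

Section probability_notions.
Context {d : measure_display} {Omega : measurableType d} {R : realType}.
Variable P : probability Omega R.
Local Open Scope ereal_scope.

Definition is_atom (A : set Omega) : Prop :=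
  [/\ measurable A, 0 < P A &
      forall B, measurable B -> B `<=` A -> P B = 0 \/ P B = P A].

Definition without_atoms : Prop := forall A, ~ is_atom A.

(* Cells may be empty, so finite partitions are included. *)
Definition countably_valued {T : Type} (G : Omega -> T) : Prop :=
  exists (A : nat -> T) (O : nat -> set Omega),
    [/\ forall i, measurable (O i), trivIset setT O,
        \bigcup_i O i = setT & forall i w, O i w -> G w = A i].

(* Uniform a.s. limits, with respect to the distance [dst], of
   countably-valued maps. *)
Definition ess_uniform_limit {T : Type} (dst : T -> T -> \bar R)
    (F : Omega -> T) : Prop :=
  exists2 G : nat -> Omega -> T, forall n, countably_valued (G n) &
    ess_sup P (fun w => dst (G n w) (F w)) @[n --> \oo] --> 0.

Section random_elements.
Context {T : topologicalType}.
Variables (U : set T) (X : nat -> Omega -> T).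

Definition independent_elements : Prop :=
  forall (J : {fset nat}) (B : nat -> set T),
    (forall i, i \in J -> borel_on U (B i)) ->
    P (\bigcap_(i in [set` J]) (X i @^-1` B i)) =
    \prod_(i <- J) P (X i @^-1` B i).

Definition identically_distributed : Prop :=
  forall i j (B : set T), borel_on U B -> P (X i @^-1` B) = P (X j @^-1` B).

End random_elements.

Section bochner.
Context {E : completeNormedModType R}.

Definition measurable_map (f : Omega -> E) : Prop :=
  ess_uniform_limit (fun x y : E => `|x - y|%:E) f.

Definition simple_map (s : Omega -> E) : Prop :=
  finite_set (range s) /\ forall x, measurable (s @^-1` [set x]).

Definition simple_integral (s : Omega -> E) : E :=
  (\sum_(x \in range s) fine (P (s @^-1` [set x])) *: x)%R.

(* A relation rather than an operator, so that no value is assigned to maps that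
   are not integrable; [y] is unique when it exists. *)
Definition is_bochner_integral (f : Omega -> E) (y : E) : Prop :=
  measurable_map f /\
  exists s : nat -> Omega -> E,
    [/\ forall n, simple_map (s n),
        \int[P]_w `|s n w - f w|%:E @[n --> \oo] --> 0 &
        simple_integral (s n) @[n --> \oo] --> y].

Definition random_set (F : Omega -> cbset E) : Prop :=
  ess_uniform_limit (fun A B : cbset E => hausdorff A B) F /\
  \int[P]_w set_norm (F w) < +oo.

Definition selections (F : Omega -> cbset E) : set (Omega -> E) :=
  [set f | measurable_map f /\ forall w, (F w : set E) (f w)].

Definition expectation_set (F : Omega -> cbset E) : set E :=
  closure [set y | exists2 f, selections F f & is_bochner_integral f y].

End bochner.

End probability_notions.

(* Main.v *)
Require Import Defs.
From HB Require Import structures.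
From mathcomp Require Import all_boot all_order all_algebra.
From mathcomp Require Import finmap.
From mathcomp Require Import all_classical all_reals all_analysis.
From mathcomp Require Import measurable_realfun ess_sup_inf.
From mathcomp Require Import ring lra zify.

(** Why the law of large numbers holds for these random sets.

    The first point is that the common law of the [X n] is carried, up to any
    error [e], by finitely many balls.  If no finite union of balls of radius [e]
    centered at a dense sequence had probability one, then, by independence,
    almost every sequence of sets would leave each of these unions; but the
    sequence stays in a compact subset of [U], which is contained in one of them
    ([essentially_covered]).  Hence, up to [e], the set [X n w] is [A (idx n w)],
    where [A] is a finite family of sets and the labels [idx n] are pairwise
    independent and identically distributed ([finite_discretization]).

    For a finite family the matter is elementary.  Minkowski addition is
    commutative, so the sum of the first [n] sets is the sum over [j] of the
    [N j]-fold sums of [A j], where [N j] counts the visits of [j]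
    ([set_sum_cellsP]).  The frequency [N j / n] tends almost surely to the
    probability [p j] by the strong law of large numbers for events
    ([frequency_cvg]), and the [N]-fold sum of a set divided by [N] fills up its
    convex hull as [N] grows ([sumset_hull], [hull_sumset]).  The averages thus
    approach the sum of the sets [p j *: hull (A j)].

    It remains to see that this sum is [C], up to a multiple of [e].  On the one
    hand a combination of points [a j] of [A j] with weights [p j] is the integral
    of a simple selection of the discretized set, and it is close to the integral
    of a selection of [X 0], obtained as a uniform limit of simple selections of
    finer and finer discretizations ([approximate_selection]); as [C] is convex,
    points of the hulls may be taken instead ([hull_combination_thicken]).  On the
    other hand the integral of a selection of [X 0] is close to the integral of a
    simple map, whose values may be moved into the sets [A j]; grouping the values
    by [j] exhibits a combination of points of the hulls
    ([selection_integral_hull]).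

    Letting [e] run through a sequence tending to 0 gives Fisher convergence
    outside a single null set ([fisher_cvg_of_cell_models]).  Distances to a set
    are 1-Lipschitz, so that the convergence is uniform on [C] if [C] is compact
    ([fisher_cvg_compact]). *)

Set Implicit Arguments.
Unset Strict Implicit.
Unset Printing Implicit Defensive.

Import Order.TTheory GRing.Theory Num.Theory.
Import numFieldNormedType.Exports.

Local Open Scope classical_set_scope.
Local Open Scope ring_scope.

(** * Convex hulls, thickenings and Minkowski sums *)

Section convexity.
Context {R : realType} {V : lmodType R}.
Implicit Types (A K : set V) (x y : V) (t : R).

Definition convex_closed K :=
  forall x y t, 0 <= t -> t <= 1 -> K x -> K y -> K (t *: x + (1 - t) *: y).

Lemma convex_setP K : convex_set (K : set (convex_lmodType V)) -> convex_closed K.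
Proof.
move=> cK x y t t0 t1 Kx Ky.
exact: set_mem (cK x y (Itv01 t0 t1) (mem_set Kx) (mem_set Ky)).
Qed.

Definition hull A : set V := [set x | forall K, convex_closed K -> A `<=` K -> K x].

Lemma sub_hull A : A `<=` hull A.
Proof. by move=> x Ax K _ AK; exact: AK. Qed.

Lemma hull_min A K : convex_closed K -> A `<=` K -> hull A `<=` K.
Proof. by move=> cK AK x Ax; exact: Ax. Qed.

Lemma convex_hull A : convex_closed (hull A).
Proof.
by move=> x y t t0 t1 Ax Ay K cK AK; apply: (cK) => //; [exact: Ax|exact: Ay].
Qed.

(** The weights [s] and [t] are not normalized, and may both vanish: this
    is what lets sums of weights be built up one term at a time. *)
Lemma convex_combine K x y s t : convex_closed K -> K x -> K y ->
  0 <= s -> 0 <= t -> exists2 z, K z & s *: x + t *: y = (s + t) *: z.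
Proof.
move=> cK Kx Ky s0 t0; have [st0|st_neq0] := eqVneq (s + t) 0.
  have [-> ->] : s = 0 /\ t = 0 by split; lra.
  by exists x; rewrite // !scale0r !addr0 scale0r.
have st : 0 < s + t by rewrite lt_neqAle eq_sym st_neq0 addr_ge0.
exists ((s / (s + t)) *: x + (1 - s / (s + t)) *: y).
  apply: cK => //; first by rewrite divr_ge0// ltW.
  by rewrite ler_pdivrMr// mul1r lerDl.
rewrite scalerDr !scalerA mulrCA divff// mulr1 mulrBr mulr1 mulrCA divff// mulr1.
by rewrite addrAC subrr add0r.
Qed.

Lemma convex_weighted_sum K (I : Type) (r : seq I) (w : I -> R) (x : I -> V) :
  convex_closed K -> K !=set0 -> (forall i, 0 <= w i) -> (forall i, K (x i)) ->
  exists2 z, K z & \sum_(i <- r) w i *: x i = (\sum_(i <- r) w i) *: z.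
Proof.
move=> cK [k0 Kk0] w0 Kx; elim: r => [|i r [z Kz IH]].
  by exists k0; rewrite // !big_nil scale0r.
rewrite !big_cons IH; apply: convex_combine => //.
by apply: sumr_ge0 => j _; exact: w0.
Qed.

End convexity.

Section thickening.
Context {R : realType} {V : normedModType R}.
Implicit Types (A C : set V) (x y : V) (e : R).

(** Membership in a thickening is a statement about points, with no infimum
    to manipulate; excesses are bounded through it. *)
Definition thicken e C : set V := [set x | exists2 c, C c & `|x - c| <= e].

Lemma convex_thicken C e : convex_closed C -> convex_closed (thicken e C).
Proof.
move=> cC x y t t0 t1 [c Cc xc] [c' Cc' yc'].
exists (t *: c + (1 - t) *: c'); first exact: cC.
rewrite opprD addrACA -!scalerBr (le_trans (ler_normD _ _))// !normrZ.
have t1' : 0 <= 1 - t by rewrite subr_ge0.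
rewrite !ger0_norm//.
have -> : e = t * e + (1 - t) * e by lra.
by apply: lerD; rewrite ler_wpM2l.
Qed.

Lemma thicken_mono C e e' : e <= e' -> thicken e C `<=` thicken e' C.
Proof. by move=> ee' x [c Cc xc]; exists c; rewrite // (le_trans xc). Qed.

Lemma thicken_trans C x y e e' :
  thicken e C y -> `|x - y| <= e' -> thicken (e + e') C x.
Proof.
move=> [c Cc yc] xy; exists c => //.
by rewrite (le_trans (ler_distD y _ _))// addrC lerD.
Qed.

Lemma hull_bounded A (M : R) : (forall x, A x -> `|x| <= M) ->
  forall x, hull A x -> `|x| <= M.
Proof.
move=> AM; apply: hull_min => // x y t t0 t1 /= xM yM.
have t1' : 0 <= 1 - t by rewrite subr_ge0.
rewrite (le_trans (ler_normD _ _))// !normrZ !ger0_norm//.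
have -> : M = t * M + (1 - t) * M by lra.
by apply: lerD; rewrite ler_wpM2l.
Qed.

End thickening.

Section minkowski_sums.
Context {V : zmodType}.
Implicit Types (A B C : set V).

Lemma set_addA : associative (@set_add V).
Proof.
move=> A B C; apply/seteqP; split => x.
  move=> [a Aa] [_ [b Bb] [c Cc <-] <-]; exists (a + b); first by exists a => //; exists b.
  by exists c; rewrite // addrA.
move=> [_ [a Aa] [b Bb <-] [c Cc <-]]; exists a => //; exists (b + c); last by rewrite addrA.
by exists b => //; exists c.
Qed.

Lemma set_addC : commutative (@set_add V).
Proof.
by move=> A B; apply/seteqP; split => x [a Aa] [b Bb <-];
  exists b => //; exists a; rewrite // addrC.
Qed.

Lemma set_add0 : left_id [set 0] (@set_add V).
Proof.
move=> A; apply/seteqP; split => x; first by move=> [_ ->] [a Aa <-]; rewrite add0r.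
by move=> Ax; exists 0 => //; exists x; rewrite // add0r.
Qed.

HB.instance Definition _ :=
  Monoid.isComLaw.Build (set V) [set 0] set_add set_addA set_addC set_add0.

Lemma set_sumP (I : finType) (B : I -> set V) x :
  (\big[set_add/[set 0]]_i B i) x <->
  exists2 y : I -> V, (forall i, B i (y i)) & x = \sum_i y i.
Proof.
suff H (r : seq I) : uniq r -> forall x, (\big[set_add/[set 0]]_(i <- r) B i) x <->
    exists2 y : I -> V, (forall i, i \in r -> B i (y i)) & x = \sum_(i <- r) y i.
  rewrite -big_enum; split=> [/(H _ (enum_uniq I))|] [y By ->]; last first.
    apply/(H _ (enum_uniq I)); exists y; [by move=> i _; exact: By|by rewrite big_enum].
  exists y; last by rewrite big_enum.
  by move=> i; apply: By; rewrite mem_enum.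
elim: r => [_ y|i r IH /= /andP[ir ur] y].
  rewrite !big_nil; split => [->|[z _ ->]]; last by rewrite big_nil.
  by exists (fun=> 0) => //; rewrite big_nil.
rewrite big_cons; split.
  move=> [b Bb] [_ /(IH ur)[z Bz ->] <-].
  exists (fun j => if j == i then b else z j).
    move=> j; rewrite in_cons; case: eqP => [->//|_ /= jr]; exact: Bz.
  rewrite big_cons eqxx; congr (_ + _); apply: eq_big_seq => j jr.
  by case: eqP => // ji; rewrite -ji jr in ir.
move=> [z Bz ->]; rewrite big_cons; exists (z i); first by apply: Bz; rewrite mem_head.
exists (\sum_(j <- r) z j) => //; apply/IH => //; exists z => // j jr.
by apply: Bz; rewrite in_cons jr orbT.
Qed.

Definition sumset A (N : nat) : set V := iter N (set_add A) [set 0].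

Lemma sumsetD A (m n : nat) : sumset A (m + n) = set_add (sumset A m) (sumset A n).
Proof.
elim: m => [|m IH]; first by rewrite set_add0.
by rewrite addSn /= -set_addA; congr set_add; exact: IH.
Qed.

(** Minkowski addition being commutative, a sum of sets drawn from a finite
    family depends only on how often each set occurs. *)
Lemma set_sum_cellsP (I : finType) (A : I -> set V) (idx : nat -> I) n x :
  (\big[set_add/[set 0]]_(i < n) A (idx i)) x <->
  exists2 y : I -> V, (forall j, sumset (A j) (\sum_(i < n) (idx i == j)) (y j)) &
    x = \sum_j y j.
Proof.
rewrite (partition_big (fun i : 'I_n => idx i) predT)//=.
apply: iff_trans (set_sumP (fun j => sumset (A j) (\sum_(i < n) (idx i == j))) x).
rewrite (eq_bigr (fun j => sumset (A j) (\sum_(i < n) (idx i == j))))// => j _.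
rewrite (eq_bigr (fun=> A j)); last by move=> i /eqP ->.
rewrite big_const_seq -sum1_count big_mkcond /= /sumset.
by congr (iter _ _ _); apply: eq_bigr => i _; case: eqP.
Qed.

End minkowski_sums.

Section hull_of_sums.
Context {R : realType} {V : normedModType R}.
Implicit Types (A B : set V) (x y : V).

(** Without convexity the sum of [N] copies of [A] is smaller than [N] times
    the hull of [A]; this is the easy inclusion. *)
Lemma sumset_hull A N y : A !=set0 -> sumset A N y ->
  exists2 z, hull A z & y = N%:R *: z.
Proof.
move=> [a0 Aa0]; elim: N y => [|N IH] y /=.
  by move=> ->; exists a0; [exact: sub_hull|rewrite scale0r].
move=> [a Aa] [_ /IH[z Az ->] <-].
have [z' Az'] := convex_combine (@convex_hull _ _ A) (sub_hull Aa) Az ler01 (ler0n R N).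
by rewrite scale1r => ->; exists z' => //; rewrite nat1r.
Qed.

(** Nonconvexity disappears under averaging: the defect of the [N]-fold sum of
    [A] with respect to [N] times its hull stays bounded as [N] grows, hence
    vanishes after division by [N].  The points with bounded defect form a
    convex set, because a combination with weight [t] is approximated by using
    the first point about [t * N] times and the second one for the rest. *)
Lemma hull_sumset A x : hull A x ->
  exists M : R, forall N, exists2 y, sumset A N y & `|y - N%:R *: x| <= M.
Proof.
move: x; apply: hull_min => [x x' t t0 t1 /= [M HM] [M' HM']|x Ax].
  exists (M + M' + `|x - x'|) => N.
  have tN0 : 0 <= t * N%:R by rewrite mulr_ge0.
  have /andP[kt tk] := truncn_itv tN0.
  (* [k] of the [N] summands serve [x], the other ones [x']; rounding [t * N]
     to [k] costs less than the distance from [x] to [x']. *)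
  set k := Num.truncn (t * N%:R) in kt tk.
  have kN : (k <= N)%N.
    by rewrite -(ler_nat R) (le_trans kt)// ler_piMl.
  have [y Ay yx] := HM k; have [y' Ay' yx'] := HM' (N - k)%N.
  exists (y + y'); first by rewrite -(subnKC kN) sumsetD; exists y => //; exists y'.
  have -> : N%:R *: (t *: x + (1 - t) *: x') =
      k%:R *: x + (N - k)%:R *: x' + (t * N%:R - k%:R) *: (x - x').
    rewrite scalerBr addrACA -scalerDl -scalerBl scalerDr !scalerA natrB//.
    by congr (_ *: _ + _ *: _); ring.
  rewrite opprD addrA opprD addrACA (le_trans (ler_normB _ _))// lerD//.
    by rewrite (le_trans (ler_normD _ _))// lerD.
  rewrite normrZ ler_piMl// ger0_norm ?subr_ge0// lerBlDl.
  by rewrite natr1 ltW.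
exists 0 => N; exists (N%:R *: x); last by rewrite subrr normr0.
elim: N => [|N IH] /=; first by rewrite scale0r.
by exists x => //; exists (N%:R *: x); rewrite // -nat1r scalerDl scale1r.
Qed.

End hull_of_sums.

(** * Averages of finitely many sets *)

Section cell_averages.
Context {R : realType} {E : normedModType R} {I : finType}.
Variables (A : I -> set E) (p : I -> R).
Implicit Types (C : set E) (idx : nat -> I).

Definition visits idx (j : I) (n : nat) : nat := \sum_(i < n) (idx i == j).

Definition frequency_gap idx n : R := \sum_j `|(visits idx j n)%:R / n%:R - p j|.

(** The combination is affine in each point [x j] separately, and a thickening
    of a convex set is convex; so the points may be moved from [A j] to its hull
    one index at a time. *)
Lemma hull_combination_thicken C (e : R) : convex_closed C ->
  (forall a, (forall j, A j (a j)) -> thicken e C (\sum_j p j *: a j)) ->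
  forall x, (forall j, hull (A j) (x j)) -> thicken e C (\sum_j p j *: x j).
Proof.
move=> cC CA x Ax.
(* [r] lists the indices already moved to the hull. *)
suff H (r : seq I) : forall x, (forall j, j \in r -> hull (A j) (x j)) ->
    (forall j, j \notin r -> A j (x j)) -> thicken e C (\sum_j p j *: x j).
  by apply: (H (enum I)) => // j; rewrite mem_enum.
elim: r {x Ax} => [|j0 r IH] x xr xnr; first by apply: CA => j; exact: xnr.
pose subst y j := if j == j0 then y else x j.
pose K := [set y | thicken e C (\sum_j p j *: subst y j)].
have sumE y : \sum_j p j *: subst y j = p j0 *: y + \sum_(j | j != j0) p j *: x j.
  rewrite (bigD1 j0)//= /subst eqxx; congr (_ + _); apply: eq_bigr => j.
  by move=> /negbTE ->.
have cK : convex_closed K.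
  move=> y z t t0 t1; rewrite /K/= !sumE => Ky Kz.
  set s := \sum_(j | _) _ in Ky Kz *.
  have := convex_thicken cC t0 t1 Ky Kz; congr (thicken _ _ _).
  rewrite !scalerDr addrACA !scalerA -scalerDl [t + _]addrC subrK scale1r.
  by congr (_ *: _ + _ *: _ + _); ring.
have AK : A j0 `<=` K.
  move=> y Ay; apply: IH => j; rewrite /subst; case: eqP => [-> //|/eqP jj0] jr.
  - exact: sub_hull.
  - by apply: xr; rewrite in_cons jr orbT.
  - by apply: xnr; rewrite in_cons negb_or jj0.
have := hull_min cK AK (xr j0 (mem_head _ _)).
rewrite /K/=; congr (thicken _ _ _); apply: eq_bigr => j _.
by rewrite /subst; case: eqP => // ->.
Qed.

Variable M : R.
Hypothesis A_bounded : forall j a, A j a -> `|a| <= M.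

Lemma frequencies_vs_weights idx n x : (forall j, hull (A j) (x j)) ->
  `|\sum_j ((visits idx j n)%:R / n%:R) *: x j - \sum_j p j *: x j|
    <= M * frequency_gap idx n.
Proof.
move=> Ax; rewrite -sumrB /frequency_gap mulr_sumr (le_trans (ler_norm_sum _ _ _))//.
apply: ler_sum => j _; rewrite -scalerBl normrZ [M * _]mulrC ler_wpM2l//.
by apply: (hull_bounded (@A_bounded j)); exact: Ax.
Qed.

Lemma cell_average_thicken C (e : R) idx n x : convex_closed C ->
  (forall j, A j !=set0) ->
  (forall a, (forall j, A j (a j)) -> thicken e C (\sum_j p j *: a j)) ->
  (\big[set_add/[set 0]]_(i < n) A (idx i)) x ->
  thicken (e + M * frequency_gap idx n) C (n%:R^-1 *: x).
Proof.
move=> cC A0 CA /(set_sum_cellsP A idx)[y Ay ->].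
have /choice[m Hm] j : exists m, hull (A j) m /\ y j = (visits idx j n)%:R *: m.
  by have [m Am ym] := sumset_hull (A0 j) (Ay j); exists m.
have Am j : hull (A j) (m j) by have [] := Hm j.
have -> : n%:R^-1 *: (\sum_j y j) = \sum_j ((visits idx j n)%:R / n%:R) *: m j.
  rewrite scaler_sumr; apply: eq_bigr => j _.
  by have [_ ->] := Hm j; rewrite scalerA mulrC.
apply: thicken_trans (frequencies_vs_weights idx n Am).
exact: hull_combination_thicken.
Qed.

(** The constant [L] does not depend on the sequence of labels: the averages
    approach the combination of hulls as soon as the frequencies do. *)
Lemma cell_average_approx x : (forall j, hull (A j) (x j)) ->
  exists L : R, forall idx n, (0 < n)%N ->
    exists2 y, (\big[set_add/[set 0]]_(i < n) A (idx i)) y &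
      `|\sum_j p j *: x j - n%:R^-1 *: y| <= L / n%:R + M * frequency_gap idx n.
Proof.
move=> Ax; have /choice[L HL] j := hull_sumset (Ax j).
exists (\sum_j L j) => idx n n0.
have /choice[y Hy] j : exists y, sumset (A j) (visits idx j n) y /\
    `|y - (visits idx j n)%:R *: x j| <= L j.
  by have [y] := HL j (visits idx j n); exists y.
exists (\sum_j y j).
  by apply/(set_sum_cellsP A idx); exists y => // j; have [] := Hy j.
rewrite distrC (le_trans (ler_distD (\sum_j ((visits idx j n)%:R / n%:R) *: x j) _ _))//.
apply: lerD (frequencies_vs_weights idx n Ax).
rewrite scaler_sumr -sumrB mulr_suml (le_trans (ler_norm_sum _ _ _))//.
apply: ler_sum => j _; rewrite mulrC -scalerA -scalerBr normrZ mulrC.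
by rewrite gtr0_norm ?invr_gt0 ?ltr0n// ler_wpM2r ?invr_ge0//; have [] := Hy j.
Qed.

End cell_averages.

Section fisher_convergence.
Context {R : realType} {E : normedModType R}.
Implicit Types (X Y : nat -> set E) (C : set E).

Lemma set_sum_thicken X Y n (e : R) x : (forall i, X i `<=` thicken e (Y i)) ->
  (\big[set_add/[set 0]]_(i < n) X i) x ->
  thicken (n%:R * e) (\big[set_add/[set 0]]_(i < n) Y i) x.
Proof.
move=> XY; elim: n x => [|n IH] x.
  by rewrite !big_ord0 => ->; exists 0; rewrite // subrr normr0 mul0r.
rewrite !big_ord_recr/= => -[x' /IH[y' Yy' xy'] [x'' /XY[y'' Yy'' xy''] <-]].
exists (y' + y''); first by exists y' => //; exists y''.
by rewrite opprD addrACA (le_trans (ler_normD _ _))// -natr1 mulrDl mul1r lerD.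
Qed.

(** Up to an error [e], the sets [X n] run through finitely many bounded sets
    [A j], visited with limiting frequencies [p j], and the [p]-combination of the
    hulls of the [A j] is [C].  The two halves of that last comparison are the last
    two clauses; the first one of them speaks of points of the [A j] only, which
    is enough when [C] is convex. *)
Definition cell_model X C (e : R) := exists (I : finType) (A : I -> set E)
    (p : I -> R) (idx : nat -> I),
  [/\ forall j, A j !=set0 /\ exists M, forall a, A j a -> `|a| <= M,
      forall j, (visits idx j n)%:R / n%:R @[n --> \oo] --> p j,
      forall i, X i `<=` thicken e (A (idx i)) /\ A (idx i) `<=` thicken e (X i),
      forall a, (forall j, A j (a j)) -> thicken e C (\sum_j p j *: a j) &
      forall z, C z -> exists2 x, (forall j, hull (A j) (x j)) &
        `|z - \sum_j p j *: x j| <= e].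

Lemma cell_model_mono X C (e e' : R) : e <= e' ->
  cell_model X C e -> cell_model X C e'.
Proof.
move=> ee' [I [A [p [idx [A0 fp XA CA AC]]]]]; exists I, A, p, idx; split => //.
- move=> i; split => x xA; apply: (thicken_mono ee').
    exact: (XA i).1.
  exact: (XA i).2.
- by move=> a Aa; apply: (thicken_mono ee'); exact: CA.
- by move=> z /AC[x Ax zx]; exists x => //; exact: le_trans ee'.
Qed.

Lemma uniform_bound {I : finType} (A : I -> set E) :
  (forall j, exists M, forall a, A j a -> `|a| <= M) ->
  exists2 M : R, 0 <= M & forall j a, A j a -> `|a| <= M.
Proof.
move=> /choice[M HM]; exists (\sum_j `|M j|); first exact: sumr_ge0.
move=> j a /HM aM; rewrite (le_trans aM)// (le_trans (ler_norm _))//.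
by rewrite (bigD1 j)//= lerDl sumr_ge0.
Qed.

Lemma frequency_gap_cvg0 {I : finType} (p : I -> R) idx :
  (forall j, (visits idx j n)%:R / n%:R @[n --> \oo] --> p j) ->
  frequency_gap p idx n @[n --> \oo] --> (0 : R).
Proof.
move=> fp; rewrite -[X in _ --> X](@big1_eq _ _ +%R I (index_enum I) predT).
apply: cvg_big => [|j _]; first exact: add_continuous.
apply/cvgrPdist_le => e e0; move/cvgrPdist_le : (fp j) => /(_ _ e0).
by apply: filterS => n; rewrite sub0r normrN normr_id distrC.
Qed.

Lemma set_average_thicken X C (e : R) : convex_closed C -> 0 < e ->
  cell_model X C e ->
  \forall n \near \oo, set_average X n `<=` thicken (4 * e) C.
Proof.
move=> cC e0 [I [A [p [idx [A0b fp XA CA _]]]]].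
have A0 j : A j !=set0 by have [] := A0b j.
have [M M0 AM] := uniform_bound (fun j => (A0b j).2).
have g0 : M * frequency_gap p idx n @[n --> \oo] --> (0 : R).
  by rewrite -(mulr0 M); apply: cvgM; [exact: cvg_cst|]; exact: frequency_gap_cvg0.
near=> n => _ [x Sx <-].
have n0 : (0 < n)%N by near: n; exists 1%N.
have ge : M * frequency_gap p idx n <= e.
  near: n; move/cvgrPdist_le : g0 => /(_ _ e0).
  by apply: filterS => n; rewrite sub0r normrN; apply: le_trans (ler_norm _).
have nR : 0 < n%:R :> R by rewrite ltr0n.
have ne : 0 < n%:R * e by rewrite mulr_gt0.
have [s [Ss /= xs]] := Sx _ (nbhsx_ballx x _ ne).
rewrite -ball_normE/= in xs.
have [a Aa sa] := set_sum_thicken (fun i => (XA i).1) Ss.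
have -> : 4 * e = (e + e) + (e + e) by ring.
apply: (@thicken_trans _ _ C _ (n%:R^-1 *: a)).
  have [c Cc ac] := cell_average_thicken AM cC A0 CA Aa.
  by exists c => //; rewrite (le_trans ac)// lerD2l.
rewrite -scalerBr normrZ gtr0_norm ?invr_gt0// ler_pdivrMl//.
rewrite mulrDr (le_trans (ler_distD s _ _))// lerD//; exact: ltW.
Unshelve. all: by end_near. Qed.

Lemma set_average_approx X C (e : R) z : 0 < e -> cell_model X C e -> C z ->
  \forall n \near \oo, thicken (4 * e) (set_average X n) z.
Proof.
move=> e0 [I [A [p [idx [A0b fp XA _ CA]]]]] Cz.
have [M M0 AM] := uniform_bound (fun j => (A0b j).2).
have g0 : M * frequency_gap p idx n @[n --> \oo] --> (0 : R).
  by rewrite -(mulr0 M); apply: cvgM; [exact: cvg_cst|]; exact: frequency_gap_cvg0.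
have [x Ax zx] := CA _ Cz.
have [L HL] := cell_average_approx p AM Ax.
near=> n.
have n0 : (0 < n)%N by near: n; exists 1%N.
have nR : 0 < n%:R :> R by rewrite ltr0n.
have ge : M * frequency_gap p idx n <= e.
  near: n; move/cvgrPdist_le : g0 => /(_ _ e0).
  by apply: filterS => n; rewrite sub0r normrN; apply: le_trans (ler_norm _).
have Le : L / n%:R <= e.
  rewrite ler_pdivrMr// -ler_pdivrMl// (le_trans (ler_norm _))//.
  by near: n; exact: nbhs_infty_ger.
have [a Aa xa] := HL idx n n0.
have [s Ss as_] := set_sum_thicken (fun i => (XA i).2) Aa.
exists (n%:R^-1 *: s); first by exists s => //; exact: subset_closure.
have -> : 4 * e = e + (e + e + e) by ring.
rewrite (le_trans (ler_distD (\sum_j p j *: x j) _ _))// lerD//.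
rewrite (le_trans (ler_distD (n%:R^-1 *: a) _ _))// lerD//.
  by rewrite (le_trans xa)// lerD.
by rewrite -scalerBr normrZ gtr0_norm ?invr_gt0// ler_pdivrMl.
Unshelve. all: by end_near. Qed.

End fisher_convergence.

(** * From models to convergence of sets *)

Section set_convergence.
Context {R : realType} {E : normedModType R}.
Implicit Types (X : nat -> set E) (A C : set E) (z : E) (e : R).

Lemma ereal_cvg0 (f : nat -> \bar R) :
  (forall e, 0 < e -> \forall n \near \oo, (0 <= f n <= e%:E)%E) ->
  f n @[n --> \oo] --> 0%E.
Proof.
move=> f0; apply/fine_cvgP; split.
  near=> n; have /andP[f0n fn1] : (0 <= f n <= 1%:E)%E by near: n; exact: f0.
  by rewrite ge0_fin_numE// (le_lt_trans fn1)// ltry.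
apply/cvgrPdist_le => e e0; near=> n.
have /andP[f0n fne] : (0 <= f n <= e%:E)%E by near: n; exact: f0.
rewrite sub0r normrN /= ger0_norm ?fine_ge0// -lee_fin fineK//.
by rewrite ge0_fin_numE// (le_lt_trans fne)// ltry.
Unshelve. all: by end_near. Qed.

Lemma set_dist_thicken z A e : thicken e A z -> (set_dist z A <= e%:E)%E.
Proof. by move=> [a Aa za]; rewrite (le_trans (set_dist_le z Aa))// lee_fin. Qed.

Lemma excess_thicken A C e : A `<=` thicken e C -> (excess A C <= e%:E)%E.
Proof.
by move=> AC; apply: ge_ereal_sup => _ [x /AC xC <-]; exact: set_dist_thicken.
Qed.

Lemma excess_nonneg A C : A !=set0 -> (0 <= excess A C)%E.
Proof.
by move=> [a Aa]; rewrite (le_trans _ (excess_ge C Aa))// set_dist_ge0.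
Qed.

Lemma fisher_cvg_of_cell_models X C : convex_closed C -> C !=set0 ->
  (forall e, 0 < e -> cell_model X C e) -> fisher_cvg (set_average X) C.
Proof.
move=> cC [c Cc] XC; split; last first.
  move=> z Cz; apply: ereal_cvg0 => e e0.
  have e4 : 0 < e / 4 by rewrite divr_gt0.
  apply: filterS (set_average_approx e4 (XC _ e4) Cz) => n.
  rewrite mulrCA divff// mulr1 => zX.
  by rewrite set_dist_ge0 set_dist_thicken.
apply: ereal_cvg0 => e e0.
have e4 : 0 < e / 4 by rewrite divr_gt0.
have := set_average_thicken cC e4 (XC _ e4).
apply: filterS2 (set_average_approx e4 (XC _ e4) Cc) => n.
rewrite mulrCA divff// mulr1 => -[x Xx _] XnC.
by rewrite excess_nonneg ?excess_thicken//; exists x.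
Qed.

(** The distances to the sets [A n] are 1-Lipschitz, so that their pointwise
    convergence to 0 is uniform on the compact set [C]. *)
Lemma fisher_cvg_compact (A : nat -> set E) C : compact C -> C !=set0 ->
  fisher_cvg A C -> hausdorff_cvg A C.
Proof.
move=> Ccpt C0 [AC CA]; apply: ereal_cvg0 => e e0.
have exc : \forall n \near \oo, (excess (A n) C <= e%:E)%E.
  have /fine_cvgP[fA /cvgrPdist_le/(_ _ e0)] := AC.
  apply: filterS2 fA => n fAn; rewrite sub0r normrN => /(le_trans (ler_norm _)).
  by rewrite -lee_fin fineK.
have dst : \forall n \near \oo, C `<=` [set z | (set_dist z (A n) <= e%:E)%E].
  have /compact_near_coveringP Ccov := Ccpt.
  apply: (Ccov nat \oo (fun n z => (set_dist z (A n) <= e%:E)%E)) => z Cz.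
  have e2 : 0 < e / 2 by rewrite divr_gt0.
  have /fine_cvgP[fz /cvgrPdist_le/(_ _ e2) zA] := CA z Cz.
  near=> y n => /=.
  have zy : `|y - z| < e / 2.
    by rewrite distrC; near: y; apply/nbhs_normP; exists (e / 2).
  have zAn : (set_dist z (A n) <= (e / 2)%:E)%E.
    have fzn : set_dist z (A n) \is a fin_num by near: n.
    rewrite -(fineK fzn) lee_fin (le_trans (ler_norm _))//.
    by near: n; apply: filterS zA => n; rewrite sub0r normrN.
  rewrite (le_trans (set_dist_triangle y z (A n)))//.
  by rewrite (splitr e) EFinD leeD// lee_fin ltW.
apply: filterS2 exc dst => n An Cn.
rewrite /hausdorff ge_max An le_max (excess_nonneg _ C0) orbT/=.
by apply: ge_ereal_sup => _ [z Cz <-]; exact: Cn.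
Unshelve. all: by end_near. Qed.

End set_convergence.

(** * Frequencies of pairwise independent events *)

Section frequencies.
Context {d : measure_display} {Omega : measurableType d} {R : realType}.
Variable P : probability Omega R.
Variables (A : nat -> set Omega) (p : R).
Hypothesis A_measurable : forall i, measurable (A i).
Hypothesis A_prob : forall i, P (A i) = p%:E.
Hypothesis A_indep : forall i j, i != j -> P (A i `&` A j) = (p * p)%:E.

Let S n w : R := \sum_(i < n) \1_(A i) w.

Let S_measurable n : measurable_fun setT (S n).
Proof. by apply: measurable_sum => i; exact: measurable_indic. Qed.

Let p_ge0 : 0 <= p.
Proof. by rewrite -lee_fin -(A_prob 0) measure_ge0. Qed.

Let S_ge0 n w : 0 <= S n w.
Proof. by apply: sumr_ge0 => i _. Qed.

Let integral_S n : (\int[P]_w (S n w)%:E = (n%:R * p)%:E)%E.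
Proof.
under eq_integral do rewrite /S -sumEFin.
rewrite ge0_integral_sum//; last first.
- by move=> i; apply/measurable_EFinP; exact: measurable_indic.
rewrite (eq_bigr (fun=> p%:E)) => [|i _]; last first.
  by rewrite integral_indic// setIT; exact: A_prob.
by rewrite sumEFin sumr_const card_ord; congr (_%:E); rewrite mulr_natl.
Qed.

Let integral_sqrS n :
  (\int[P]_w (S n w ^+ 2)%:E = (n%:R * (n%:R * (p * p) + (p - p * p)))%:E)%E.
Proof.
have sqrE w : ((S n w ^+ 2)%:E = \sum_(i < n) \sum_(j < n) (\1_(A i `&` A j) w)%:E)%E.
  rewrite expr2 /S mulr_suml -sumEFin; apply: eq_bigr => i _.
  rewrite mulr_sumr -sumEFin; apply: eq_bigr => j _.
  by rewrite indicI.
under eq_integral do rewrite sqrE.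
rewrite ge0_integral_sum//; last 2 first.
- move=> i; apply: emeasurable_sum => j; apply/measurable_EFinP.
  by apply: measurable_indic; exact: measurableI.
- by move=> i w _; apply: sume_ge0 => j _; rewrite lee_fin.
rewrite (eq_bigr (fun=> (n%:R * (p * p) + (p - p * p))%:E)).
  by rewrite sumEFin sumr_const card_ord; congr (_%:E); rewrite -[LHS]mulr_natl.
move=> i _; rewrite ge0_integral_sum//; last first.
- move=> j; apply/measurable_EFinP.
  by apply: measurable_indic; exact: measurableI.
rewrite (eq_bigr (fun j : 'I_n => (p * p + (p - p * p) *+ (j == i))%:E)).
  rewrite sumEFin big_split/= sumr_const card_ord -(mulr_natl (p * p)).
  congr (_ + _)%:E.
  by rewrite (bigD1 i)//= eqxx mulr1n big1 ?addr0// => j /negbTE ->.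
move=> j _; rewrite integral_indic ?setIT//; last exact: measurableI.
have [->|ji] := eqVneq j i.
  by rewrite setIid mulr1n addrC subrK; exact: A_prob.
by rewrite mulr0n addr0; apply: A_indep; rewrite eq_sym.
Qed.

Let dev n w : R := S n w - n%:R * p.

Let dev_measurable n : measurable_fun setT (fun w => dev n w ^+ 2).
Proof. by apply: measurable_funX; apply: measurable_funB. Qed.

(** The variance of the number of occurrences is at most [n].  Expanding the
    square as [dev ^+ 2 + 2 n p S = S ^+ 2 + (n p) ^+ 2] keeps every integrand
    nonnegative. *)
Let integral_sqrdev n : (\int[P]_w (dev n w ^+ 2)%:E <= n%:R%:E)%E.
Proof.
have np0 : 0 <= 2 * (n%:R * p) by rewrite !mulr_ge0.
have : (\int[P]_w ((dev n w ^+ 2)%:E + (2 * (n%:R * p))%:E * (S n w)%:E) =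
        \int[P]_w ((S n w ^+ 2)%:E + ((n%:R * p) ^+ 2)%:E))%E.
  apply: eq_integral => w _; rewrite -EFinM -!EFinD; congr (_%:E).
  by rewrite /dev; ring.
rewrite ge0_integralD//; last 4 first.
- by move=> w _; rewrite lee_fin sqr_ge0.
- exact/measurable_EFinP.
- by move=> w _; rewrite -EFinM lee_fin mulr_ge0.
- by apply: emeasurable_funM => //; exact/measurable_EFinP.
rewrite ge0_integralZl_EFin//; last 2 first.
- by move=> w _; rewrite lee_fin.
- exact/measurable_EFinP.
rewrite integral_S ge0_integralD//; last 3 first.
- by move=> w _; rewrite lee_fin sqr_ge0.
- by apply/measurable_EFinP; exact: measurable_funX.
- by move=> w _; rewrite lee_fin sqr_ge0.
rewrite integral_sqrS integral_cst// [X in _ = (_ + _ * X)%E]probability_setT mule1.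
rewrite -EFinM -EFinD.
move=> /(congr1 (fun x => x - (2 * (n%:R * p) * (n%:R * p))%:E)%E).
rewrite addeK// -EFinB => ->; rewrite lee_fin.
have -> : n%:R * (n%:R * (p * p) + (p - p * p)) + (n%:R * p) ^+ 2 -
  2 * (n%:R * p) * (n%:R * p) = n%:R * (p - p * p) by ring.
apply: ler_piMr => //.
have p1 : p <= 1 by rewrite -lee_fin -(A_prob 0); exact: probability_le1.
nra.
Qed.

(** The bound follows by induction from the telescoping estimate
    [1 / (x + 1) ^+ 2 <= 1 / x - 1 / (x + 1)]. *)
Let sum_inv_sqr n : \sum_(k < n.+1) (k.+1%:R ^+ 2)^-1 <= 2 - n.+1%:R^-1 :> R.
Proof.
elim: n => [|n IH]; first by rewrite big_ord_recr big_ord0/= add0r expr1n invr1; lra.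
rewrite big_ord_recr/=; apply: le_trans (lerD IH (lexx _)) _.
rewrite -addrA lerD2l -(natr1 n.+1).
have : 0 < n.+1%:R :> R by [].
set x : R := n.+1%:R => x0.
rewrite -subr_ge0.
have -> : - (x + 1)^-1 - (- x^-1 + ((x + 1) ^+ 2)^-1) = (x * (x + 1) ^+ 2)^-1.
  by field; apply/andP; split; lra.
by rewrite invr_ge0 mulr_ge0 ?sqr_ge0// ltW.
Qed.

Let dev_step m n w : (m <= n)%N -> `|dev n w - dev m w| <= (n - m)%:R.
Proof.
move=> mn; rewrite -(subnKC mn) addKn.
elim: (n - m)%N => [|k IH]; first by rewrite addn0 subrr normr0.
rewrite addnS -natr1; apply: le_trans (ler_distD (dev (m + k) w) _ _) _.
rewrite addrC; apply: lerD => //.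
have -> : dev (m + k).+1 w - dev (m + k) w = \1_(A (m + k)) w - p.
  by rewrite /dev /S big_ord_recr/= -natr1; ring.
have p1 : p <= 1 by rewrite -lee_fin -(A_prob 0); exact: probability_le1.
have p0 := p_ge0; rewrite ler_norml indicE; case: (_ \in _); rewrite /= ?mulr1n ?mulr0n;
  by apply/andP; split; lra.
Qed.

(** Along the squares the second moments of the deviations are summable, so
    the deviations tend to 0 almost surely. *)
Let dev_subsequence : {ae P, forall w,
  dev (k.+1 ^ 2) w / (k.+1 ^ 2)%:R @[k --> \oo] --> (0 : R)}.
Proof.
pose u k w := ((dev (k.+1 ^ 2) w / (k.+1 ^ 2)%:R) ^+ 2)%:E.
have u0 k w : (0 <= u k w)%E by rewrite lee_fin sqr_ge0.
have um k : measurable_fun setT (u k).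
  apply/measurable_EFinP; apply: measurable_funX; apply: measurable_funM => //.
  exact: measurable_funB.
have uint k : (\int[P]_w u k w <= ((k.+1%:R ^+ 2)^-1)%:E)%E.
  pose c : R := ((k.+1 ^ 2)%:R ^+ 2)^-1.
  have c0 : 0 <= c by rewrite invr_ge0 sqr_ge0.
  under eq_integral do rewrite /u expr_div_n mulrC EFinM.
  rewrite ge0_integralZl_EFin//; last 2 first.
  - by move=> w _; rewrite lee_fin sqr_ge0.
  - exact/measurable_EFinP.
  apply: le_trans (lee_wpmul2l _ (integral_sqrdev _)) _; first by rewrite lee_fin.
  by rewrite -EFinM lee_fin /c expr2 invfM mulfVK ?natrX// pnatr_eq0.
have sum_fin : (\int[P]_w \sum_(k <oo) u k w < +oo)%E.
  rewrite integral_nneseries//.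
  apply: (@le_lt_trans _ _ 2%:E); last exact: ltry.
  apply: lime_le; first by apply: is_cvg_nneseries => k _ _; exact: integral_ge0.
  apply: nearW => -[|n]; first by rewrite big_geq ?lee_fin.
  rewrite big_mkord; apply: (@le_trans _ _ (\sum_(k < n.+1) ((k.+1%:R ^+ 2)^-1)%:E)%E).
    apply: lee_sum => k _; exact: uint.
  rewrite sumEFin lee_fin.
  by rewrite (le_trans (sum_inv_sqr n))// gerBl.
have : P.-integrable setT (fun w => \sum_(k <oo) u k w)%E.
  apply/integrableP; split; first exact: ge0_emeasurable_sum.
  under eq_integral => w _ do rewrite gee0_abs ?nneseries_ge0//.
  exact: sum_fin.
move=> /integrable_ae => /(_ measurableT); apply: filterS => w /(_ I) uw.
have tail : (\sum_(N <= k <oo) u k w)%E @[N --> \oo] --> 0%E.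
  by apply: nneseries_tail_cvg => //; rewrite ltey_eq uw.
apply/norm_cvg0P/cvgrPdist_le => e e0.
have : (fun k => u k w) @ \oo --> 0%E.
  apply: squeeze_cvge (cvg_cst 0%E) tail; apply: nearW => k; rewrite u0/=.
  by rewrite (le_trans _ (nneseries_lim_ge k.+1 _))// big_nat1.
move=> /fine_cvgP[_ /cvgrPdist_le/(_ (e ^+ 2))]; rewrite exprn_gt0// => /(_ isT).
apply: filterS => k /=; rewrite !sub0r !normrN normr_id normrX.
by rewrite ler_pXn2r ?nnegrE// ltW.
Qed.

(** The strong law of large numbers for pairwise independent events of equal
    probability.  Between two consecutive squares the deviation varies by at most
    the gap, which is negligible with respect to [n]. *)
Lemma frequency_cvg :
  {ae P, forall w, (\sum_(i < n) \1_(A i) w) / n%:R @[n --> \oo] --> p}.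
Proof.
apply: filterS dev_subsequence => w devw.
apply/cvgrPdist_le => e e0; have e3 : 0 < e / 3 by rewrite divr_gt0.
move/cvgrPdist_le : devw => /(_ _ e3)[K _ HK].
near=> n.
have n0 : 0 < n%:R :> R by rewrite ltr0n; near: n; exists 1%N.
pose K' := maxn K (Num.truncn (3 / e)).
have [k [K'k kn nk]] : exists k, [/\ (K' <= k)%N, (k.+1 ^ 2 <= n)%N & (n < k.+2 ^ 2)%N].
  have PK : exists k, (k.+1 ^ 2 <= n)%N.
    by exists K'; near: n; exists (K'.+1 ^ 2)%N.
  have Pn k : (k.+1 ^ 2 <= n)%N -> (k <= n)%N.
    by move=> /(leq_trans _); apply; rewrite -mulnn; nia.
  case: (ex_maxnP PK Pn) => k Pk maxk; exists k; split => //.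
    by apply: maxk; near: n; exists (K'.+1 ^ 2)%N.
  by rewrite ltnNge; apply/negP => /maxk; rewrite ltnn.
have Kk : (K <= k)%N by rewrite (leq_trans _ K'k)// leq_maxl.
have ek : 1 <= e / 3 * k.+1%:R.
  rewrite -ler_pdivrMl// mulr1 invf_div (le_trans (ltW (truncnS_gt _)))//.
  by rewrite ler_nat ltnS (leq_trans _ K'k)// leq_maxr.
rewrite distrC.
have -> : (\sum_(i < n) \1_(A i) w) / n%:R - p = dev n w / n%:R.
  by rewrite /dev mulrBl mulrAC divff ?mul1r// gt_eqF.
rewrite normrM normfV (ger0_norm (ltW n0)) ler_pdivrMr//.
have devk : `|dev (k.+1 ^ 2) w| <= e / 3 * (k.+1 ^ 2)%:R.
  have := HK k Kk; rewrite /= sub0r normrN normrM normfV normr_nat.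
  by rewrite ler_pdivrMr// ltr0n expn_gt0.
apply: (@le_trans _ _ (`|dev n w - dev (k.+1 ^ 2) w| + `|dev (k.+1 ^ 2) w|)).
  by rewrite -[X in `|X| <= _](subrK (dev (k.+1 ^ 2) w)) ler_normD.
have nkR : (n - k.+1 ^ 2)%:R <= 2 * k.+1%:R :> R.
  by rewrite -natrM ler_nat leq_subLR; move: nk; rewrite -!mulnn; nia.
have knR : k.+1%:R ^+ 2 <= n%:R :> R by rewrite -natrX ler_nat.
apply: le_trans (lerD (le_trans (dev_step w kn) nkR) devk) _.
rewrite natrX; have k0 : 0 < k.+1%:R :> R by [].
set x := k.+1%:R in ek knR k0 *.
have : x <= e / 3 * x ^+ 2 by rewrite expr2 mulrA ler_peMl// ltW.
nra.
Unshelve. all: by end_near. Qed.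

End frequencies.

(** * Measurability of random sets *)

Section null_sets.
Context {d : measure_display} {Omega : measurableType d} {R : realType}.
Variable P : probability Omega R.

Lemma ae_exists (Q : Omega -> Prop) : {ae P, forall w, Q w} -> exists w, Q w.
Proof.
have P0 : (0 < P setT)%E by rewrite probability_setT lte01.
have ? := ae_properfilter_algebraOfSetsType P0.
exact: filter_ex.
Qed.

Lemma probability1_ae (A : set Omega) : measurable A -> P A = 1%E ->
  {ae P, forall w, A w}.
Proof.
move=> mA PA; exists (~` A); split => //; first exact: measurableC.
by rewrite [LHS](probability_setC P)// PA subee.
Qed.

Lemma measurable_ae_eq (A B : set Omega) : measure_is_complete P ->
  measurable B -> {ae P, forall w, A w <-> B w} -> measurable A.
Proof.
move=> Pc mB [N [mN N0 AB]].
rewrite (_ : A = (B `\` N) `|` (A `&` N)); last first.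
  apply/seteqP; split => [w Aw|w [[Bw Nw]|[]]//].
    have [Nw|Nw] := pselect (N w); first by right.
    left; split => //; by apply/not_notP => Bw; apply: Nw; apply: AB => -[/(_ Aw)].
  by apply/not_notP => Aw; apply: Nw; apply: AB => -[_ /(_ Bw)].
apply: measurableU; first exact: measurableD.
by apply: Pc; exists N; split => // w [].
Qed.

Lemma countably_valued_measurable (T : Type) (G : Omega -> T) (W : set T) :
  countably_valued G -> measurable (G @^-1` W).
Proof.
move=> [A [cell [cell_measurable _ cell_cover GA]]].
rewrite (_ : _ @^-1` _ = \bigcup_(i in [set i | W (A i)]) cell i).
  exact: bigcup_measurable.
apply/seteqP; split => [w Ww|w [i /= WA Oiw]]; last by rewrite /= (GA i).
have [i _ Oiw] : (\bigcup_i cell i) w by rewrite cell_cover.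
by exists i => //=; rewrite -(GA _ _ Oiw).
Qed.

End null_sets.

Section borel_sets.
Context {T : topologicalType} (U : set T).

(** The Borel sets of [U] are traces of Borel sets of the whole space, where
    complements are easier to handle. *)
Lemma borel_trace (B : set T) : <<s @open T >> B -> borel_on U (B `&` U).
Proof.
move: B; apply: (smallest_sub (C := sigma_algebra setT)); last first.
  by move=> V oV; apply: sub_sigma_algebra; exists V.
split => [|B BU|F FU].
- by rewrite /= set0I; exact: sigma_algebra0.
- have -> : (setT `\` B) `&` U = U `\` (B `&` U).
    by rewrite setTD setDIr setDv setU0 setDE setIC.
  exact: sigma_algebraCD.
- by rewrite /= setI_bigcupl; apply: (@sigma_algebra_bigcup _ U) => i; exact: FU.
Qed.

Lemma borel_setC (A : set T) : <<s @open T >> A -> <<s @open T >> (~` A).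
Proof. by rewrite -setTD; exact: sigma_algebraCD. Qed.

Lemma borel_setI (A B : set T) :
  <<s @open T >> A -> <<s @open T >> B -> <<s @open T >> (A `&` B).
Proof.
move=> bA bB; rewrite -(setCK (A `&` B)) setCI -bigcup2E; apply: borel_setC.
apply: (@sigma_algebra_bigcup _ setT) => -[|[|i]] /=;
  [exact: borel_setC|exact: borel_setC|exact: sigma_algebra0].
Qed.

End borel_sets.

Section measurable_random_set.
Context {d : measure_display} {Omega : measurableType d} {R : realType}
  {E : normedModType R}.
Variable P : probability Omega R.
Hypothesis P_complete : measure_is_complete P.
Variable X : Omega -> cbset E.
Hypothesis X_limit :
  ess_uniform_limit P (fun A B : cbset E => hausdorff A B) X.

(** Let [G n] be countably valued with essential distance at most [e n] to [X].
    Outside a null set, [X w] is in [V] if and only if, for some [n], the closed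
    ball of radius [e n] around [G n w] is contained in [V]. *)
Lemma random_set_preimage_open (V : set (cbset E)) : open V -> measurable (X @^-1` V).
Proof.
move=> oV; have [G Gcount GX] := X_limit.
set e := fun n => ess_sup _ _ in GX.
pose W n := [set A : cbset E | forall B, ((mdist A B)%:E <= e n)%E -> V B].
apply: (measurable_ae_eq (B := \bigcup_n (G n @^-1` W n)) P_complete).
  by apply: bigcup_measurable => n _; exact: countably_valued_measurable.
have : {ae P, forall w, forall n, (hausdorff (G n w) (X w) <= e n)%E}.
  by apply/ae_foralln => n; exact: ess_sup_ge.
apply: filterS => w GXw; split=> [Vw|[n _ /=]]; last first.
  by apply; rewrite cbset_mdistE.
have /nbhs_ballP[r /= r0 rV] := open_nbhs_nbhs (conj oV Vw).
have r2 : 0 < r / 2 by rewrite divr_gt0.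
have [n en] : exists n, (e n < (r / 2)%:E)%E.
  have := GX; move=> /fine_cvgP[efin /cvgrPdist_lt/(_ _ r2) er].
  have [n [efn]] := filter_ex (filterI efin er).
  by rewrite sub0r normrN => /(le_lt_trans (ler_norm _)); exists n; rewrite -(fineK efn).
exists n => //= B GB; apply: rV; rewrite ballEmdist /=.
apply: le_lt_trans (metric_triangle _ (G n w) _) _.
rewrite (splitr r) -lte_fin !EFinD lteD//.
  by rewrite metric_sym cbset_mdistE (le_lt_trans (GXw n)).
by rewrite (le_lt_trans GB).
Qed.

Lemma random_set_preimage_borel (B : set (cbset E)) :
  <<s @open (cbset E) >> B -> measurable (X @^-1` B).
Proof.
move: B; apply: (smallest_sub (C := sigma_algebra setT)); last first.
  by move=> V oV; exact: random_set_preimage_open.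
split => [|B BU|F FU].
- by rewrite /= preimage_set0.
- by rewrite /= setTD preimage_setC; exact: measurableC.
- by rewrite /= preimage_bigcup; exact: bigcup_measurable.
Qed.

End measurable_random_set.

(** * Finite discretization of the common law *)

Section discretization.
Context {R : realType} {E : normedModType R} {d : measure_display}
  {Omega : measurableType d}.
Variable P : probability Omega R.
Hypothesis P_complete : measure_is_complete P.
Variables (U : set (cbset E)) (X : nat -> Omega -> cbset E).
Hypothesis U_neq0 : U !=set0.
Hypothesis U_separable : separable_set U.
Hypothesis X_limit :
  forall n, ess_uniform_limit P (fun A B : cbset E => hausdorff A B) (X n).
Hypothesis X_in_U : forall n w, U (X n w).
Hypothesis X_independent : independent_elements P U X.
Hypothesis X_identically_distributed : identically_distributed P U X.
Hypothesis X_compact : {ae P, forall w, exists Z : set (cbset E),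
  [/\ Z !=set0, compact Z, Z `<=` U & forall n, Z (X n w)]}.

Let preimage_trace n (B : set (cbset E)) : X n @^-1` (B `&` U) = X n @^-1` B.
Proof. by apply/seteqP; split => [w []//|w Bw]; split => //; exact: X_in_U. Qed.

Lemma same_probability i j (B : set (cbset E)) : <<s @open (cbset E) >> B ->
  P (X i @^-1` B) = P (X j @^-1` B).
Proof.
move=> bB; rewrite -(preimage_trace i) -(preimage_trace j).
exact: X_identically_distributed (borel_trace bB).
Qed.

Lemma finite_independence (J : {fset nat}) (B : set (cbset E)) :
  <<s @open (cbset E) >> B ->
  P (\bigcap_(i in [set` J]) (X i @^-1` B)) = (\prod_(i <- J) P (X 0 @^-1` B))%E.
Proof.
move=> bB; under eq_bigcapr do rewrite -preimage_trace.
rewrite (X_independent (B := fun=> B `&` U)); last by move=> i _; exact: borel_trace.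
by apply: eq_bigr => i _; rewrite preimage_trace; exact: same_probability.
Qed.

Lemma pairwise_independence i j (B : set (cbset E)) : i != j ->
  <<s @open (cbset E) >> B ->
  P (X i @^-1` B `&` X j @^-1` B) = (P (X 0 @^-1` B) * P (X 0 @^-1` B))%E.
Proof.
move=> ij bB; have := finite_independence [fset i; j]%fset bB.
rewrite big_fsetU1 ?inE//= big_seq_fset1 => <-; congr (P _).
apply/seteqP; split => [w [iw jw] k|w H].
  by rewrite /= !inE => /orP[] /eqP ->.
by split; apply: H; rewrite /= !inE eqxx ?orbT.
Qed.

Lemma dense_sequence : exists c : nat -> cbset E,
  forall e A, 0 < e -> U A -> exists n, mdist A (c n) < e.
Proof.
have [u0 Uu0] := U_neq0; have [D [cD _ UD]] := U_separable.
(* An empty dense subset would make [U] empty. *)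
have /pfcard_geP[D0|[f]] := cD.
  by have := UD _ Uu0; rewrite D0 closure0.
exists f => e A e0 /UD /(_ (ball A e) (nbhsx_ballx A _ e0))[a [Da Aa]].
have [n _ fn] := @surj _ _ _ _ f a Da.
by exists n; rewrite fn; move: Aa; rewrite ballEmdist.
Qed.

Variable c : nat -> cbset E.
Variable e : R.
Hypothesis e_gt0 : 0 < e.
Hypothesis c_dense : forall A, U A -> exists n, mdist A (c n) < e.

Let near_center (A : cbset E) (j : nat) := mdist A (c j) < e.

(** The length of the list labels the sets near none of the listed centers. *)
Let first_center (A : cbset E) (r : seq nat) := find (near_center A) r.

Let open_near_center j : open [set A | near_center A j].
Proof.
rewrite openE => A /= Aj; apply/nbhs_ballP; exists (e - mdist A (c j)).
  by rewrite /= subr_gt0.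
move=> B; rewrite ballEmdist /= ltrBrDr => AB; apply: le_lt_trans AB.
by rewrite (metric_sym A B) metric_triangle.
Qed.

Let borel_first_center (r : seq nat) k : <<s @open (cbset E) >> [set A | first_center A r = k].
Proof.
have near_borel j : <<s @open (cbset E) >> [set A | near_center A j].
  exact: sub_sigma_algebra.
elim: r k => [|j r IH] k; rewrite /first_center /=.
  have [->|k0] := eqVneq k 0%N.
    rewrite (_ : [set _ | _] = ~` set0); last first.
      by apply/seteqP; split => [A _ []|A _] /=.
    by apply: borel_setC; exact: sigma_algebra0.
  rewrite (_ : [set _ | _] = set0); first exact: sigma_algebra0.
  by apply/seteqP; split => // A /= k0'; rewrite -k0' in k0.
case: k => [|k].
  rewrite (_ : [set _ | _] = [set A | near_center A j])//.
  by apply/seteqP; split => A /=; case: ifP.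
rewrite (_ : [set _ | _] = ~` [set A | near_center A j] `&` [set A | first_center A r = k]).
  by apply: borel_setI => //; exact: borel_setC.
apply/seteqP; split => A /=; first by case: ifP => // nA [] ?; split => //; rewrite nA.
by case=> /negP/negbTE ->; rewrite /first_center => ->.
Qed.

Let covered m := [set A | has (near_center A) (iota 0 m)].

Let borel_covered m : <<s @open (cbset E) >> (covered m).
Proof.
rewrite (_ : covered m = ~` [set A | first_center A (iota 0 m) = m]).
  by apply: borel_setC; exact: borel_first_center.
apply/seteqP; split => A; rewrite /covered/= has_find /first_center size_iota.
  by move=> /[swap] ->; rewrite ltnn.
move=> /eqP nm; rewrite ltn_neqAle nm/= -[X in (_ <= X)%N](size_iota 0 m).
exact: find_size.
Qed.

Let preimage_covered n m : measurable (X n @^-1` covered m).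
Proof. exact: (random_set_preimage_borel P_complete (X_limit n) (borel_covered m)). Qed.

Let covered_near m A j : (j < m)%N -> near_center A j -> covered m A.
Proof. by move=> jm Aj; apply/hasP; exists j; rewrite // mem_iota. Qed.

(** By independence the first [N] terms stay near the first [m] centers with
    probability [P B ^+ N], which tends to 0. *)
Let all_covered_null m : (P (X 0 @^-1` covered m) < 1)%E ->
  {ae P, forall w, exists n, ~ covered m (X n w)}.
Proof.
set B := X 0 @^-1` _ => B1.
have mcov n : measurable (X n @^-1` covered m) by exact: preimage_covered.
have Bfin : P B \is a fin_num by apply: fin_num_measure; exact: mcov.
have B0 : 0 <= fine (P B) by apply: fine_ge0; exact: measure_ge0.
exists (\bigcap_n X n @^-1` covered m); split.
- exact: bigcapT_measurable.
- apply/eqP; rewrite -measure_le0; apply/lee_addgt0Pr => r r0; rewrite add0e.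
  have : (fun N => fine (P B) ^+ N) @ \oo --> 0.
    by apply: cvg_expr; rewrite ger0_norm//; rewrite -lte_fin fineK.
  move=> /cvgrPdist_le/(_ _ r0) /filter_ex[N].
  rewrite sub0r normrN ger0_norm ?exprn_ge0// -lee_fin; apply: le_trans.
  pose J := [fset i in iota 0 N]%fset.
  have -> : ((fine (P B)) ^+ N)%:E =
      P (\bigcap_(i in [set` J]) X i @^-1` covered m).
    rewrite finite_independence// -(fineK Bfin) prodEFin; congr (_%:E).
    rewrite big_const_seq count_predT iter_mulr mulr1.
    by rewrite card_fseq undup_id ?iota_uniq// size_iota.
  apply: le_measure; rewrite ?inE; [exact: bigcapT_measurable| |].
    exact: fin_bigcap_measurable.
  by move=> w Hw i _; exact: Hw.
- move=> w Hw n _; apply/not_notP => nw; by apply: Hw; exists n.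
Qed.

(** The common law is essentially carried by finitely many balls.  Otherwise
    almost every sequence would leave every finite union of balls, whereas a compact
    subset of [U] containing the sequence is contained in one of them. *)
Lemma essentially_covered : exists m, forall n, {ae P, forall w, covered m (X n w)}.
Proof.
have [m Pm] : exists m, P (X 0 @^-1` covered m) = 1%E.
  apply/not_existsP => Hm.
  have Hlt m : (P (X 0 @^-1` covered m) < 1)%E.
    rewrite lt_neqAle probability_le1; last exact: preimage_covered.
    by rewrite andbT; apply/eqP; exact: Hm.
  have Hesc : {ae P, forall w, forall m, exists n, ~ covered m (X n w)}.
    by apply/ae_foralln => m; exact: all_covered_null.
  have [w [[Z [_ Zc ZU XZ]] wesc]] := ae_exists (filterI X_compact Hesc).
  move/compact_near_coveringP : Zc => Zcov.
  have : \forall m \near \oo, Z `<=` covered m.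
    apply: (Zcov nat \oo (fun m A => covered m A)) => A ZA.
    have [j Aj] := c_dense (ZU _ ZA).
    have nearA : nbhs A [set B | near_center B j].
      by apply: open_nbhs_nbhs; split; [exact: open_near_center|exact: Aj].
    near=> B m.
    apply: (@covered_near m B j); first by near: m; exists j.+1.
    by near: B; exact: nearA.
  move=> /filter_ex[m Zm]; have [n] := wesc m.
  by apply; apply: Zm; exact: XZ.
exists m => n; apply: probability1_ae; first exact: preimage_covered.
by rewrite -Pm; exact: same_probability.
Unshelve. all: by end_near. Qed.

Lemma discretization_at_centers : exists (m : nat) (idx : nat -> Omega -> 'I_m.+1),
  [/\ forall n j, measurable (idx n @^-1` [set j]),
      forall n j, P (idx n @^-1` [set j]) = P (idx 0%N @^-1` [set j]),
      forall n k j, n != k -> P (idx n @^-1` [set j] `&` idx k @^-1` [set j]) =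
        (P (idx 0%N @^-1` [set j]) * P (idx 0%N @^-1` [set j]))%E &
      {ae P, forall w, forall n, mdist (X n w) (c (idx n w)) <= e}].
Proof.
have [m mcov] := essentially_covered.
pose idx n w : 'I_m.+1 := inord (first_center (X n w) (iota 0 m)).
have first_le A : (first_center A (iota 0 m) < m.+1)%N.
  by rewrite ltnS -[X in (_ <= X)%N](size_iota 0 m) find_size.
pose cell (j : 'I_m.+1) := [set A | first_center A (iota 0 m) = j].
have idxE n j : idx n @^-1` [set j] = X n @^-1` cell j.
  apply/seteqP; split => w; rewrite /idx /cell /=.
    by move=> <-; rewrite inordK.
  by move=> wj; apply/val_inj; rewrite /= inordK.
have cell_borel j : <<s @open (cbset E) >> (cell j) by exact: borel_first_center.
exists m, idx; split => [n j|n j|n k j nk|].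
- rewrite idxE.
  exact: (random_set_preimage_borel P_complete (X_limit n) (cell_borel j)).
- by rewrite !idxE; exact: same_probability.
- by rewrite !idxE; exact: pairwise_independence.
apply/ae_foralln => n; apply: filterS (mcov n) => w.
rewrite /covered/= => hasX; have := hasX; rewrite has_find size_iota => lt_m.
rewrite /idx inordK//; have := nth_find 0%N hasX.
by rewrite nth_iota// add0n => /ltW.
Qed.

End discretization.

Section finite_discretization.
Context {R : realType} {E : normedModType R} {d : measure_display}
  {Omega : measurableType d}.
Variable P : probability Omega R.

Lemma finite_discretization (U : set (cbset E)) (X : nat -> Omega -> cbset E) (e : R) :
  measure_is_complete P -> U !=set0 -> separable_set U ->
  (forall n, ess_uniform_limit P (fun A B : cbset E => hausdorff A B) (X n)) ->
  (forall n w, U (X n w)) -> independent_elements P U X ->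
  identically_distributed P U X ->
  {ae P, forall w, exists Z : set (cbset E),
    [/\ Z !=set0, compact Z, Z `<=` U & forall n, Z (X n w)]} ->
  0 < e ->
  exists (I : finType) (A : I -> cbset E) (idx : nat -> Omega -> I),
  [/\ forall n j, measurable (idx n @^-1` [set j]),
      forall n j, P (idx n @^-1` [set j]) = P (idx 0%N @^-1` [set j]),
      forall n k j, n != k -> P (idx n @^-1` [set j] `&` idx k @^-1` [set j]) =
        (P (idx 0%N @^-1` [set j]) * P (idx 0%N @^-1` [set j]))%E &
      {ae P, forall w, forall n, (hausdorff (X n w) (A (idx n w)) <= e%:E)%E}].
Proof.
move=> Pc U0 Usep Xlim XU Xind Xid Xcpt e0.
have [c c_dense] := dense_sequence U0 Usep.
have [m [idx [mi pi ii di]]] := discretization_at_centers Pc Xlim XU Xind Xid Xcpt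
  (fun A UA => c_dense e A e0 UA).
exists 'I_m.+1, (fun j : 'I_m.+1 => c j), idx; split => //.
by apply: filterS di => w dw n; rewrite -cbset_mdistE lee_fin.
Qed.

End finite_discretization.

(** * Integrals of maps with finitely many values *)

Section finite_labels.
Context {d : measure_display} {Omega : measurableType d} {R : realType}.
Variable P : probability Omega R.

Definition measurable_label {I : Type} (g : Omega -> I) :=
  forall i, measurable (g @^-1` [set i]).

Definition weight {I : Type} (g : Omega -> I) (i : I) : R :=
  fine (P (g @^-1` [set i])).

(** Factoring a map through a finite type of labels makes pairs and images of
    such maps immediate, and turns integrals into sums over labels. *)
Definition finitely_labelled {T : Type} (f : Omega -> T) :=
  exists (I : finType) (g : Omega -> I) (phi : I -> T),
    measurable_label g /\ f = phi \o g.

Lemma weight_ge0 {I : Type} (g : Omega -> I) i : 0 <= weight g i.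
Proof. by apply: fine_ge0; exact: measure_ge0. Qed.

Lemma measurable_label_pair {I J : Type} (g : Omega -> I) (h : Omega -> J) :
  measurable_label g -> measurable_label h ->
  measurable_label (fun w => (g w, h w)).
Proof.
move=> mg mh [i j].
rewrite (_ : _ @^-1` _ = g @^-1` [set i] `&` h @^-1` [set j]).
  exact: measurableI.
by apply/seteqP; split => w /= [-> ->].
Qed.

Lemma label_preimage_measurable {I : finType} (g : Omega -> I) (W : set I) :
  measurable_label g -> measurable (g @^-1` W).
Proof.
move=> mg; rewrite (_ : _ @^-1` _ = \bigcup_(i in W) g @^-1` [set i]).
  by apply: fin_bigcup_measurable => // i _; exact: mg.
by apply/seteqP; split => [w Ww|w [i Wi /= ->]//]; exists (g w).
Qed.

Lemma label_measurable_fun {I : finType} (g : Omega -> I) (h : I -> R) :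
  measurable_label g -> measurable_fun setT (h \o g).
Proof.
move=> mg _ B mB; rewrite setTI comp_preimage.
exact: label_preimage_measurable.
Qed.

Lemma integral_label {I : finType} (g : Omega -> I) (h : I -> R) :
  measurable_label g -> (forall i, 0 <= h i) ->
  (\int[P]_w (h (g w))%:E = (\sum_i weight g i * h i)%:E)%E.
Proof.
move=> mg h0.
have hE w : ((h (g w))%:E = \sum_i (h i)%:E * (\1_(g @^-1` [set i]) w)%:E)%E.
  rewrite (bigD1 (g w))//= big1 => [|i ig].
    by rewrite adde0 indicE mem_set// mule1.
  rewrite indicE memNset ?mule0//= => gi.
  by rewrite gi eqxx in ig.
under eq_integral do rewrite hE.
have mi i : measurable_fun setT (fun w => (\1_(g @^-1` [set i]) w)%:E : \bar R).
  by apply/measurable_EFinP; exact: measurable_indic.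
rewrite ge0_integral_sum//; last 2 first.
- by move=> i; apply: emeasurable_funM.
- by move=> i w _; rewrite mule_ge0// lee_fin.
rewrite -sumEFin; apply: eq_bigr => i _.
rewrite ge0_integralZl_EFin//.
rewrite integral_indic// setIT mulrC EFinM; congr (_ * _)%E.
by rewrite fineK//; apply: fin_num_measure; exact: mg.
Qed.

Lemma sum_weight {I : finType} (g : Omega -> I) : measurable_label g ->
  \sum_i weight g i = 1.
Proof.
move=> mg; have := @integral_label _ g (fun=> 1) mg (fun=> ler01).
rewrite integral_cst//= mul1e [X in X = _]probability_setT => -[->].
by apply: eq_bigr => i _; rewrite mulr1.
Qed.

Lemma weight_preimage {I : finType} (g : Omega -> I) (W : pred I) :
  measurable_label g ->
  fine (P (g @^-1` [set i | W i])) = \sum_(i | W i) weight g i.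
Proof.
move=> mg; have := @integral_label _ g (fun i => (W i)%:R) mg (fun i => ler0n _ _).
have WE w : (W (g w))%:R = \1_(g @^-1` [set i | W i]) w :> R.
  by rewrite indicE; have [Ww|Ww] := boolP (W (g w));
    [rewrite mem_set|rewrite memNset//=; exact/negP].
under eq_integral do rewrite WE.
rewrite integral_indic//; last exact: label_preimage_measurable.
rewrite setIT => -> /=; rewrite [RHS]big_mkcond; apply: eq_bigr => i _.
by case: ifP; rewrite ?mulr1 ?mulr0.
Qed.

Lemma weight_marginal {I J : finType} (g : Omega -> I) (h : Omega -> J) i :
  measurable_label g -> measurable_label h ->
  \sum_j weight (fun w => (g w, h w)) (i, j) = weight g i.
Proof.
move=> mg mh.
have mgh := measurable_label_pair mg mh.
have := weight_preimage (fun ij : I * J => ij.1 == i) mgh.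
rewrite (_ : _ @^-1` _ = g @^-1` [set i]); last first.
  by apply/seteqP; split => w /=; [move/eqP|move=> ->].
rewrite /weight -/(weight g i) => ->.
rewrite (reindex_onto (fun j => (i, j)) (fun ij => ij.2)) /=.
  by apply: eq_bigl => j; rewrite !eqxx.
by move=> [i' j] /= /eqP ->.
Qed.

Lemma positive_weight_ae {I : finType} (g : Omega -> I) (Q : Omega -> Prop) i :
  measurable_label g -> {ae P, forall w, Q w} -> 0 < weight g i ->
  exists2 w, g w = i & Q w.
Proof.
move=> mg QP; apply: contraPP => gQ; apply/negP; rewrite -leNgt.
rewrite le_eqVlt; apply/orP; left; apply/eqP; rewrite /weight.
suff -> : P (g @^-1` [set i]) = 0%E by [].
apply: measure_negligible; first exact: mg.
by apply: negligibleS QP => w /= gi Qw; apply: gQ; exists w.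
Qed.

Lemma finitely_labelled_comp2 {S T V : Type} (f : Omega -> S) (f' : Omega -> T)
    (h : S -> T -> V) : finitely_labelled f -> finitely_labelled f' ->
  finitely_labelled (fun w => h (f w) (f' w)).
Proof.
move=> [I [g [phi [mg ->]]]] [J [g' [psi [mg' ->]]]].
exists (I * J)%type, (fun w => (g w, g' w)), (fun ij => h (phi ij.1) (psi ij.2)).
by split => //; exact: measurable_label_pair.
Qed.

Lemma finitely_labelled_countably_valued {T : Type} (f : Omega -> T) :
  finitely_labelled f -> countably_valued f.
Proof.
have [w0 _] := ae_exists (aeW P (fun w : Omega => I)).
move=> [I [g [phi [mg ->]]]].
exists (fun n => nth (phi (g w0)) [seq phi i | i <- enum I] n).
exists (fun n => g @^-1` [set i | index i (enum I) = n]); split.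
- by move=> n; exact: label_preimage_measurable.
- by move=> i j _ _ [w /= [<- <-]].
- by apply/seteqP; split => // w _; exists (index (g w) (enum I)).
- by move=> n w /= <-; rewrite (nth_map (g w0)) ?nth_index ?index_mem ?mem_enum.
Qed.

End finite_labels.

Section simple_integrals.
Context {d : measure_display} {Omega : measurableType d} {R : realType}
  {E : completeNormedModType R}.
Variable P : probability Omega R.

Lemma simple_map_labelled (s : Omega -> E) : simple_map s <-> finitely_labelled s.
Proof.
split=> [[fs ms]|[I [g [phi [mg ->]]]]].
  have sK w : s w \in fset_set (range s) by rewrite in_fset_set// inE.
  exists (fset_set (range s) : finType), (fun w => [` sK w]%fset), val; split => //.
  move=> i; rewrite (_ : _ @^-1` _ = s @^-1` [set val i]); first exact: ms.
  by apply/seteqP; split => w /= => [<-//|si]; exact/val_inj.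
split; last by move=> x; rewrite comp_preimage; exact: label_preimage_measurable.
apply: (@sub_finite_set _ _ (phi @` setT)); first by move=> x [w _ <-]; exists (g w).
by apply: finite_image; exact: finite_finset.
Qed.

Lemma simple_integral_label {I : finType} (g : Omega -> I) (phi : I -> E) :
  measurable_label g ->
  simple_integral P (phi \o g) = \sum_i weight P g i *: phi i.
Proof.
move=> mg; rewrite /simple_integral.
have [fs _] : simple_map (phi \o g) by apply/simple_map_labelled; exists I, g, phi.
rewrite fsbig_finite//=; set F := fset_set _.
rewrite (eq_bigr (fun x => \sum_i if phi i == x then weight P g i *: phi i else 0)).
  rewrite exchange_big/=; apply: eq_bigr => i _.
  have [iF|iF] := boolP (phi i \in F).
    rewrite (bigD1_seq (phi i) iF (fset_uniq F))/= eqxx big1 ?addr0// => x.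
    by rewrite eq_sym => /negbTE ->.
  rewrite big_seq big1 => [|x xF]; last by case: eqP => // ix; rewrite ix xF in iF.
  rewrite /weight (_ : _ @^-1` _ = set0) ?measure0 ?scale0r//.
  apply/seteqP; split => // w /= gi; move/negP : iF; apply.
  by rewrite in_fset_set// inE /=; exists w; rewrite //= gi.
move=> x _; rewrite -big_mkcond/=.
rewrite (eq_bigr (fun i => weight P g i *: x)); last by move=> i /eqP ->.
rewrite -scaler_suml -weight_preimage//; congr (fine (P _) *: _).
by apply/seteqP; split => w /= /eqP.
Qed.

Lemma simple_integral_dist (s t : Omega -> E) (c : R) :
  simple_map s -> simple_map t -> {ae P, forall w, `|s w - t w| <= c} ->
  `|simple_integral P s - simple_integral P t| <= c.
Proof.
move=> /simple_map_labelled[I [g [phi [mg ->]]]] /simple_map_labelled[J [h [psi [mh ->]]]].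
move=> stc; pose gh w := (g w, h w).
have mgh : measurable_label gh by exact: measurable_label_pair.
rewrite (_ : phi \o g = (phi \o fst) \o gh)// (_ : psi \o h = (psi \o snd) \o gh)//.
rewrite !simple_integral_label// -sumrB.
apply: le_trans (ler_norm_sum _ _ _) _.
rewrite -[c]mul1r -(sum_weight P mgh) mulr_suml; apply: ler_sum => ij _.
rewrite -scalerBr normrZ ger0_norm ?weight_ge0//.
have [->|w0] := eqVneq (weight P gh ij) 0; first by rewrite !mul0r.
have {}w0 : 0 < weight P gh ij by rewrite lt_neqAle eq_sym w0 weight_ge0.
have [w <- stw] := positive_weight_ae mgh stc w0.
by rewrite ler_wpM2l// weight_ge0.
Qed.

(** The integral of a nonnegative function is a supremum over the simple
    functions below it, hence monotone even on functions that are not measurable. *)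
Lemma ge0_le_integral_any (f1 f2 : Omega -> \bar R) :
  (forall w, 0 <= f1 w)%E -> (forall w, f1 w <= f2 w)%E ->
  (\int[P]_w f1 w <= \int[P]_w f2 w)%E.
Proof.
move=> f10 f12; have f20 w : (0 <= f2 w)%E by exact: le_trans (f12 w).
rewrite !ge0_integralTE//; apply: ereal_sup_le => _ [h hf1 <-]; exists h => // w.
exact: le_trans (f12 w).
Qed.

Lemma integral_le_ae_cst (f : Omega -> R) (c : R) : (forall w, 0 <= f w) -> 0 <= c ->
  {ae P, forall w, f w <= c} -> (\int[P]_w (f w)%:E <= c%:E)%E.
Proof.
move=> f0 c0 [N [mN N0 fN]].
have -> : c%:E = (\int[P]_w c%:E)%E.
  by rewrite integral_cst// [X in (_ * X)%E]probability_setT mule1.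
(* [c] off the null set [N], and infinite on it. *)
pose f2 w := (c%:E + (\1_N w)%:E * +oo)%E.
have f2N w : ~ N w -> f2 w = c%:E by move=> wN; rewrite /f2 indicE memNset// mul0e adde0.
have mf2 : measurable_fun setT f2.
  apply: emeasurable_funD => //; apply: emeasurable_funM => //.
  by apply/measurable_EFinP; exact: measurable_indic.
have f20 w : (0 <= f2 w)%E by rewrite adde_ge0// ?lee_fin// mule_ge0// lee_fin.
rewrite [leRHS](ge0_ae_eq_integral (g := f2))//.
  apply: ge0_le_integral_any => w; first by rewrite lee_fin.
  have [wN|wN] := pselect (N w); last first.
    by rewrite f2N// lee_fin; apply/not_notP => fw; apply: wN; exact: fN.
  by rewrite /f2 indicE mem_set// mul1e addey// leey.
exists N; split => // w /= /not_implyP[_] cw; apply/not_notP => Nw.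
by apply: cw; rewrite f2N.
Qed.

Lemma integral_label_le_ae {I : finType} (g : Omega -> I) (h : I -> R)
    (f : Omega -> R) : measurable_label g -> (forall i, 0 <= h i) ->
  (forall w, 0 <= f w) -> {ae P, forall w, h (g w) <= f w} ->
  ((\sum_i weight P g i * h i)%:E <= \int[P]_w (f w)%:E)%E.
Proof.
move=> mg h0 f0 [N [mN N0 fN]].
rewrite -integral_label//.
pose k w := (h (g w) * \1_(~` N) w)%:E.
rewrite (ge0_ae_eq_integral (g := k))//.
- apply: ge0_le_integral_any => w; rewrite /k lee_fin ?mulr_ge0//.
  rewrite indicE; have [wN|wN] := boolP (w \in _); last by rewrite mulr0.
  rewrite mulr1; apply/not_notP => fw; move/set_mem : wN; apply; exact: fN.
- by apply/measurable_EFinP; exact: label_measurable_fun.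
- apply/measurable_EFinP; apply: measurable_funM.
    exact: label_measurable_fun.
  by apply: measurable_indic; exact: measurableC.
- by move=> w _; rewrite lee_fin.
- by move=> w _; rewrite lee_fin mulr_ge0.
- exists N; split => // w /= /not_implyP[_]; rewrite /k indicE => kw.
  by apply/not_notP => Nw; apply: kw; rewrite mem_set//= mulr1.
Qed.

End simple_integrals.

(** * Selections as uniform limits of simple maps *)

Section limits.
Context {R : realType} {E : completeNormedModType R}.

Lemma limit_with_rate (u : nat -> E) (c : nat -> R) :
  c n @[n --> \oo] --> (0 : R) ->
  (forall m n, (m <= n)%N -> `|u m - u n| <= c m) ->
  exists2 l, u n @[n --> \oo] --> l & forall m, `|u m - l| <= c m.
Proof.
move=> c0 uc; have : cvg (u n @[n --> \oo]).
  apply/cauchy_cvgP/cauchy_exP => e e0.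
  have [m cm] : exists m, c m < e.
    move/cvgrPdist_lt : c0 => /(_ _ e0)/filter_ex[m].
    by rewrite sub0r normrN => /(le_lt_trans (ler_norm _)); exists m.
  exists (u m); exists m => // n /= mn.
  by rewrite -ball_normE /= (le_lt_trans (uc _ _ mn)).
move=> ul; exists (lim (u n @[n --> \oo])) => // m.
apply/ler_addgt0Pr => e e0.
have [n [/= mn un]] : exists n, (m <= n)%N /\ `|lim (u n @[n --> \oo]) - u n| <= e.
  move/cvgrPdist_le : ul => /(_ _ e0) ul.
  have [n [? ?]] := filter_ex (filterI (nbhs_infty_ge m) ul).
  by exists n.
rewrite (le_trans (ler_distD (u n) _ _))// lerD ?uc//.
by rewrite distrC.
Qed.

Lemma halving_cvg0 (c : R) : c / 2 ^+ n @[n --> \oo] --> (0 : R).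
Proof.
rewrite -(mulr0 c); apply: cvgM; first exact: cvg_cst.
under eq_fun do rewrite -exprVn.
by apply: cvg_expr; rewrite ger0_norm ?invr_ge0// invf_lt1// ltr1n.
Qed.

Lemma closed_limit (A : set E) (l : E) : closed A ->
  (forall e, 0 < e -> thicken e A l) -> A l.
Proof.
move=> cA Al; rewrite (closure_id A).1// => V /nbhs_normP[e /= e0 eV].
have e2 : 0 < e / 2 by rewrite divr_gt0.
have [a Aa la] := Al _ e2; exists a; split => //; apply: eV => /=.
by rewrite (le_lt_trans la)// ltr_pdivrMr// ltr_pMr// ltr1n.
Qed.

Lemma hausdorff_thicken (A B : cbset E) (e : R) : 0 < e ->
  (hausdorff A B <= e%:E)%E -> (A : set E) `<=` thicken (2 * e) B.
Proof.
move=> e0 AB x Ax.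
have : (set_dist x B < (2 * e)%:E)%E.
  apply: (@le_lt_trans _ _ e%:E); last by rewrite lte_fin; lra.
  apply: le_trans (excess_ge _ Ax) _; apply: le_trans AB.
  by rewrite /hausdorff le_max lexx.
move=> /ereal_inf_lt[_ [y By <-]]; rewrite lte_fin => xy.
by exists y => //; exact: ltW.
Qed.

Lemma hausdorffC (A B : set E) : hausdorff A B = hausdorff B A.
Proof. by rewrite /hausdorff maxC. Qed.

End limits.

Section selection.
Context {d : measure_display} {Omega : measurableType d} {R : realType}
  {E : completeNormedModType R}.
Variable P : probability Omega R.
Variables (X : Omega -> cbset E) (delta : R) (Y : nat -> Omega -> cbset E).
Variable f0 : Omega -> E.
Hypothesis delta_gt0 : 0 < delta.
Hypothesis Y_labelled : forall k, finitely_labelled (Y k).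
Hypothesis XY : forall k,
  {ae P, forall w, (hausdorff (X w) (Y k w) <= (delta / 2 ^+ k)%:E)%E}.
Hypothesis f0_labelled : finitely_labelled f0.
Hypothesis f0_selection : forall w, (Y 0 w : set E) (f0 w).

Let rate k := delta / 2 ^+ k.

Let rate_gt0 k : 0 < rate k.
Proof. by rewrite divr_gt0// exprn_gt0. Qed.

Let rateS k : 2 * rate k.+1 = rate k.
Proof. by rewrite /rate exprS; field; exact: expf_neq0. Qed.

(** A selection of [X] close to a given selection [f0] of [Y 0]: each [f k] is a
    selection of [Y k], and [f k.+1 w] is a point of [Y k.+1 w] almost nearest to
    [f k w].  The maps [f k] are simple and converge uniformly almost surely, so
    that their limit is a selection of [X] and their integrals converge to its
    integral. *)
Lemma approximate_selection : exists (f : Omega -> E) (y : E),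
  [/\ selections P X f, is_bochner_integral P f y &
      `|y - simple_integral P f0| <= 6 * delta].
Proof.
(* [sel (k, x, A)] is a point of [A] in all cases, and a point close to [x] if
   [x] is within [3 * rate k] of [A]. *)
have /choice[sel Hsel] (kxA : nat * E * cbset E) : exists a : E, (kxA.2 : set E) a /\
    (thicken (3 * rate kxA.1.1) kxA.2 kxA.1.2 -> `|kxA.1.2 - a| <= 3 * rate kxA.1.1).
  case: kxA => -[k x] A /=.
  have [[a Aa xa]|xA] := pselect (thicken (3 * rate k) A x); first by exists a.
  by have [a Aa] := cbset_neq0 A; exists a.
pose f := fix f k w := if k is k'.+1 then sel (k', f k' w, Y k w) else f0 w.
have fY k w : (Y k w : set E) (f k w).
  by case: k => [//|k]; exact: (Hsel (k, f k w, Y k.+1 w)).1.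
have f_labelled k : finitely_labelled (f k).
  elim: k => [//|k IH].
  exact: (finitely_labelled_comp2 (fun x A => sel (k, x, A)) IH (Y_labelled k.+1)).
pose good w := forall k, (hausdorff (X w) (Y k w) <= (rate k)%:E)%E.
have good_ae : {ae P, forall w, good w} by apply/ae_foralln.
have fX k w : good w -> thicken (2 * rate k) (X w) (f k w).
  move=> gw; apply: hausdorff_thicken (fY k w) => //.
  by rewrite hausdorffC; exact: gw.
have f_step k w : good w -> `|f k w - f k.+1 w| <= 3 * rate k.
  move=> gw; apply: (Hsel (k, f k w, Y k.+1 w)).2 => /=.
  have [x Xx fx] := fX k w gw.
  have [y Yy xy] := hausdorff_thicken (rate_gt0 _) (gw k.+1) Xx.
  exists y => //; rewrite (le_trans (ler_distD x _ _))//.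
  have -> : 3 * rate k = 2 * rate k + 2 * rate k.+1 by rewrite rateS; ring.
  exact: lerD.
have f_cauchy w m n : good w -> (m <= n)%N -> `|f m w - f n w| <= 6 * rate m.
  (* The steps [3 * rate k = 6 * rate k - 6 * rate k.+1] telescope. *)
  move=> gw mn; apply: (@le_trans _ _ (6 * rate m - 6 * rate n)); last first.
    by rewrite gerBl mulr_ge0// ltW.
  rewrite -(subnKC mn); elim: (n - m)%N => [|k IH].
    by rewrite addn0 !subrr normr0.
  rewrite addnS (le_trans (ler_distD (f (m + k) w) _ _))//.
  have := f_step (m + k) w gw; have := rateS (m + k).
  by move: IH; lra.
have rate0 : 6 * rate n @[n --> \oo] --> (0 : R).
  rewrite -(mulr0 6); apply: cvgM; [exact: cvg_cst|exact: halving_cvg0].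
have rate_near e : 0 < e -> \forall n \near \oo, 6 * rate n <= e.
  move/cvgrPdist_le : rate0 => rate0 /rate0; apply: filterS => n.
  by rewrite sub0r normrN; apply: le_trans (ler_norm _).
have /choice[g Hg] w : exists l, (X w : set E) l /\
    (good w -> forall k, `|f k w - l| <= 6 * rate k).
  have [gw|ngw] := pselect (good w); last first.
    by have [a Xa] := cbset_neq0 (X w); exists a.
  have [l _ fl] := limit_with_rate rate0 (fun m n mn => f_cauchy w m n gw mn).
  exists l; split => //; apply: closed_limit; first exact: cbset_closed.
  move=> e e0; have e2 : 0 < e / 2 by rewrite divr_gt0.
  have [k ke] := filter_ex (rate_near _ e2).
  have [x Xx fx] := fX k w gw; exists x => //.
  rewrite (le_trans (ler_distD (f k w) _ _))// distrC.
  by have := fl k; have := rate_gt0 k; move: fx; lra.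
have fg k : {ae P, forall w, `|f k w - g w| <= 6 * rate k}.
  by apply: filterS good_ae => w gw; exact: (Hg w).2.
have mg : measurable_map P g.
  exists f; first by move=> n; exact: (finitely_labelled_countably_valued P).
  apply: ereal_cvg0 => e e0; apply: filterS (rate_near _ e0) => n ne.
  apply/andP; split.
    apply: ess_sup_gee; first by rewrite [X in (_ < X)%E]probability_setT lte01.
    by apply: aeW => w; rewrite lee_fin.
  apply/ess_supP; apply: filterS (fg n) => w fgw.
  by rewrite lee_fin (le_trans fgw).
have f_simple n : simple_map (f n) by apply/simple_map_labelled.
have int_cauchy m n : (m <= n)%N ->
    `|simple_integral P (f m) - simple_integral P (f n)| <= 6 * rate m.
  move=> mn; apply: simple_integral_dist => //.
  by apply: filterS good_ae => w gw; exact: f_cauchy.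
have [y fy yf] := limit_with_rate rate0 int_cauchy.
exists g, y; split; [split => // w; exact: (Hg w).1| |]; last first.
  by rewrite distrC (le_trans (yf 0%N))// /rate expr0 divr1.
split => //; exists f; split => //.
apply: ereal_cvg0 => e e0; apply: filterS (rate_near _ e0) => n ne.
rewrite integral_ge0//=; apply: integral_le_ae_cst => //; first exact: ltW.
by apply: filterS (fg n) => w fgw; rewrite (le_trans fgw).
Qed.

End selection.

(** * Expectation and the law of large numbers *)

Section selection_integrals.
Context {d : measure_display} {Omega : measurableType d} {R : realType}
  {E : completeNormedModType R}.
Variable P : probability Omega R.

Lemma almost_nearest_point (A : set E) (x : E) (e : R) : A !=set0 -> 0 < e ->
  exists2 a, A a & forall b, A b -> `|x - a| <= `|x - b| + e.
Proof.
move=> [a0 Aa0] e0; pose D := [set `|x - b| | b in A].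
have D_inf : has_inf D.
  split; first by exists `|x - a0|; exists a0.
  by exists 0 => _ [b _ <-].
have [_ [a Aa <-] xa] := inf_adherent e0 D_inf; exists a => // b Ab.
rewrite (le_trans (ltW xa))// lerD2r; apply: ge_inf; first exact: D_inf.2.
by exists b.
Qed.

(** Replace [f] by a simple map [s] close to it in mean, and the value of [s] on
    each cell by an almost nearest point of the corresponding [A j]; on a cell this
    moves [s] by little more than its distance to [f], as [f] is close to [A j].
    Collecting the cells with the same [j] gives [weight P idx j] times a convex
    combination of points of [A j]. *)
Lemma selection_integral_hull (I : finType) (X : Omega -> cbset E)
    (A : I -> cbset E) (idx : Omega -> I) (f : Omega -> E) (y : E) (e : R) :
  measurable_label idx -> 0 < e ->
  {ae P, forall w, (hausdorff (X w) (A (idx w)) <= e%:E)%E} ->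
  (forall w, (X w : set E) (f w)) -> is_bochner_integral P f y ->
  exists2 x : I -> E, (forall j, hull (A j) (x j)) &
    `|y - \sum_j weight P idx j *: x j| <= 5 * e.
Proof.
move=> midx e0 XA Xf [_ [s [s_simple sf sy]]].
have [n [sfn syn]] : exists n, (\int[P]_w `|s n w - f w|%:E <= e%:E)%E /\
    `|y - simple_integral P (s n)| <= e.
  move/fine_cvgP : sf => [sfin /cvgrPdist_le/(_ _ e0) sf].
  move/cvgrPdist_le : sy => /(_ _ e0) sy.
  have [n [[sfn sfe] syn]] := filter_ex (filterI (filterI sfin sf) sy).
  exists n; split => //; rewrite -(fineK sfn) lee_fin.
  by rewrite (le_trans (ler_norm _))// -normrN -[X in `|X|]sub0r.
have /simple_map_labelled[J [g [phi [mg sE]]]] := s_simple n.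
have /choice[a Ha] (jv : I * J) : exists a : E, (A jv.1 : set E) a /\
    forall b, (A jv.1 : set E) b -> `|phi jv.2 - a| <= `|phi jv.2 - b| + e.
  by have [a] := almost_nearest_point (phi jv.2) (cbset_neq0 (A jv.1)) e0; exists a.
pose gh w := (idx w, g w).
have mgh : measurable_label gh by exact: measurable_label_pair.
(* The displacement beyond [3 * e], which is bounded by the distance from
   [s n] to [f] at almost every point of the cell. *)
pose excess_dist jv := Num.max 0 (`|phi jv.2 - a jv| - 3 * e).
have excess_dist_ge0 jv : 0 <= excess_dist jv by rewrite le_max lexx.
have close : \sum_jv weight P gh jv * `|phi jv.2 - a jv| <= 4 * e.
  have small : \sum_jv weight P gh jv * excess_dist jv <= e.
    rewrite -lee_fin; apply: le_trans sfn.
    apply: integral_label_le_ae => //; apply: filterS XA => w XAw.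
    rewrite ge_max normr_ge0 /= lerBlDr.
    have [b Ab fb] := hausdorff_thicken e0 XAw (Xf w).
    rewrite (le_trans ((Ha (gh w)).2 b Ab))// sE /=.
    by have := ler_distD (f w) (phi (g w)) b; move: fb; lra.
  apply: (@le_trans _ _ (\sum_jv weight P gh jv * (excess_dist jv + 3 * e))).
    apply: ler_sum => jv _; rewrite ler_wpM2l ?weight_ge0//.
    by rewrite -lerBlDr le_max lexx orbT.
  under eq_bigr do rewrite mulrDr.
  rewrite big_split/= -mulr_suml sum_weight// mul1r.
  by move: small; lra.
have /choice[x Hx] j : exists x, hull (A j) x /\
    \sum_v weight P gh (j, v) *: a (j, v) = weight P idx j *: x.
  have [||v|x Ax ax] := @convex_weighted_sum _ _ (hull (A j)) J (index_enum J)
      (fun v => weight P gh (j, v)) (fun v => a (j, v)) (@convex_hull _ _ _).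
  - by have [b Ab] := cbset_neq0 (A j); exists b; exact: sub_hull.
  - by move=> v; exact: weight_ge0.
  - by apply: sub_hull; exact: (Ha (j, v)).1.
  by exists x; split => //; rewrite ax weight_marginal.
exists x; first by move=> j; exact: (Hx j).1.
have -> : \sum_j weight P idx j *: x j = \sum_jv weight P gh jv *: a jv.
  rewrite (eq_bigr (fun j => \sum_v weight P gh (j, v) *: a (j, v))).
    by rewrite pair_bigA/=; apply: eq_bigr => -[].
  by move=> j _; rewrite (Hx j).2.
rewrite (le_trans (ler_distD (simple_integral P (s n)) _ _))//.
have -> : 5 * e = e + 4 * e by ring.
apply: lerD => //; apply: le_trans close.
have -> : s n = (phi \o snd) \o gh by rewrite sE.
rewrite simple_integral_label// -sumrB (le_trans (ler_norm_sum _ _ _))//.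
apply: ler_sum => jv _; rewrite -scalerBr normrZ ger0_norm//.
exact: weight_ge0.
Qed.

End selection_integrals.

Section law_of_large_numbers.
Context {R : realType} {E : completeNormedModType R} {d : measure_display}
  {Omega : measurableType d}.
Variable P : probability Omega R.
Hypothesis P_complete : measure_is_complete P.
Variables (U : set (cbset E)) (X : nat -> Omega -> cbset E) (C : cbset E).
Hypothesis U_neq0 : U !=set0.
Hypothesis U_separable : separable_set U.
Hypothesis X_limit :
  forall n, ess_uniform_limit P (fun A B : cbset E => hausdorff A B) (X n).
Hypothesis X_in_U : forall n w, U (X n w).
Hypothesis X_independent : independent_elements P U X.
Hypothesis X_identically_distributed : identically_distributed P U X.
Hypothesis X_compact : {ae P, forall w, exists Z : set (cbset E),
  [/\ Z !=set0, compact Z, Z `<=` U & forall n, Z (X n w)]}.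
Hypothesis X_expectation : expectation_set P (X 0) = C.

Let discretize (e : R) (e0 : 0 < e) := finite_discretization P_complete U_neq0
  U_separable X_limit X_in_U X_independent X_identically_distributed X_compact e0.

(** The simple map [a \o idx] has the combination as its integral, and by
    refining the discretization it is moved to a selection of [X 0] nearby. *)
Lemma expectation_of_cells (I : finType) (A : I -> cbset E) (idx : Omega -> I)
    (a : I -> E) (e : R) : 0 < e -> measurable_label idx ->
  {ae P, forall w, (hausdorff (X 0 w) (A (idx w)) <= e%:E)%E} ->
  (forall j, (A j : set E) (a j)) ->
  thicken (7 * e) C (\sum_j weight P idx j *: a j).
Proof.
move=> e0 midx XA Aa.
have /choice[Y HY] k : exists Y : Omega -> cbset E, finitely_labelled Y /\
    {ae P, forall w, (hausdorff (X 0 w) (Y w) <= (e / 2 ^+ k)%:E)%E}.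
  have ek : 0 < e / 2 ^+ k by rewrite divr_gt0// exprn_gt0.
  have [I' [A' [idx' [midx' _ _ XA']]]] := discretize ek.
  exists (fun w => A' (idx' 0 w)); split.
    by exists I', (idx' 0%N), A'; split => // j; exact: midx'.
  by apply: filterS XA' => w; exact.
(* The refinement starts from the given cells. *)
pose Y' k := if k is 0 then fun w => A (idx w) else Y k.
have [||||f [y [fX fy yf]]] := @approximate_selection _ _ _ _ P (X 0) e Y' (a \o idx) e0.
- by case=> [|k]; [exists I, idx, A|exact: (HY k.+1).1].
- case=> [|k]; last exact: (HY k.+1).2.
  by apply: filterS XA => w; rewrite expr0 divr1.
- by exists I, idx, a.
- by move=> w; exact: Aa.
rewrite simple_integral_label// in yf.
have Cy : (C : set E) y by rewrite -X_expectation; apply: subset_closure; exists f.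
by exists y => //; rewrite distrC; lra.
Qed.

(** The discretization at distance [e / 7] is a model: the exceptional null sets
    are those of the discretization and of the frequencies of its labels, and do not
    depend on the points of [C]. *)
Lemma cell_model_ae (e : R) : 0 < e ->
  {ae P, forall w, cell_model (fun n => X n w : set E) C e}.
Proof.
move=> e0; have e7 : 0 < e / 7 by rewrite divr_gt0.
have [I [A [idx [midx pidx iidx XA]]]] := discretize e7.
have freq : {ae P, forall w, forall j : I,
    (visits (idx^~ w) j n)%:R / n%:R @[n --> \oo] --> weight P (idx 0) j}.
  apply: filter_forall => j.
  have pE i : P (idx i @^-1` [set j]) = (weight P (idx 0) j)%:E.
    rewrite pidx /weight fineK//.
    by apply: fin_num_measure; exact: (midx 0%N j).
  have iE i k : i != k -> P (idx i @^-1` [set j] `&` idx k @^-1` [set j]) =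
      (weight P (idx 0) j * weight P (idx 0) j)%:E.
    by move=> ik; rewrite iidx// EFinM !pE.
  apply: filterS (frequency_cvg (fun i => midx i j) pE iE) => w.
  apply: cvg_trans; apply: near_eq_cvg; apply: nearW => n /=; congr (_ / _).
  rewrite /visits natr_sum; apply: eq_bigr => i _; rewrite indicE; congr (_%:R).
  by case: eqP => [ij|ij]; [rewrite mem_set|rewrite memNset].
have XA0 : {ae P, forall w, (hausdorff (X 0 w) (A (idx 0%N w)) <= (e / 7)%:E)%E}.
  by apply: filterS (XA) => w; exact.
apply: filterS2 XA freq => w XAw fw.
have le7 : 2 * (e / 7) <= e by lra.
exists I, (fun j => A j : set E), (weight P (idx 0)), (idx^~ w); split.
- move=> j; split; first exact: cbset_neq0.
  have /pinfty_ex_gt0[M M0 AM] := cbset_bounded (A j).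
  by exists M => a Aa; exact: AM.
- exact: fw.
- move=> i; split => x xA; apply: (thicken_mono le7).
    exact: (hausdorff_thicken e7 (XAw i)).
  by apply: (hausdorff_thicken e7) xA; rewrite hausdorffC; exact: XAw.
- move=> a Aa; have -> : e = 7 * (e / 7) by field.
  exact: (expectation_of_cells e7 (midx 0%N) XA0 Aa).
- move=> z; rewrite -[X in X z]X_expectation => Cz.
  have [y [[f [mf Xf] fy]]] := Cz _ (nbhsx_ballx z _ e7).
  rewrite -ball_normE /= => zy.
  have [x Ax yx] := selection_integral_hull (midx 0) e7 XA0 Xf fy.
  exists x => //; rewrite (le_trans (ler_distD y _ _))//.
  by move: zy yx; lra.
Qed.

Lemma fisher_cvg_ae : convex_closed (C : set E) ->
  {ae P, forall w, fisher_cvg (set_average (fun n => X n w : set E)) C}.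
Proof.
move=> cC; have : {ae P, forall w, forall k : nat,
    cell_model (fun n => X n w : set E) C k.+1%:R^-1}.
  by apply/ae_foralln => k; apply: cell_model_ae; rewrite invr_gt0.
apply: filterS => w Xw; apply: fisher_cvg_of_cell_models => //.
  exact: cbset_neq0.
move=> e e0; have [k ke] := filter_ex (near_infty_natSinv_lt (PosNum e0)).
exact: (cell_model_mono (ltW ke) (Xw k)).
Qed.

End law_of_large_numbers.

Theorem theorem6p2 (R : realType) (E : completeNormedModType R)
  (d : measure_display) (Omega : measurableType d) (P : probability Omega R)
  (P_complete : measure_is_complete P) (P_without_atoms : without_atoms P)
  (U : set (cbset E)) (U_neq0 : U !=set0) (U_separable : separable_set U)
  (X : nat -> Omega -> cbset E)
  (X_random : forall n, random_set P (X n))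
  (X_in_U : forall n w, U (X n w))
  (X_independent : independent_elements P U X)
  (X_identically_distributed : identically_distributed P U X)
  (C : cbset E) (C_convex : convex_set (C : set (convex_lmodType E)))
  (X_expectation : forall n, expectation_set P (X n) = C)
  (X_compact : {ae P, forall w, exists Z : set (cbset E),
    [/\ Z !=set0, compact Z, Z `<=` U & forall n, Z (X n w)]}) :
  {ae P, forall w, fisher_cvg (set_average (fun n => X n w : set E)) C} /\
  (compact (C : set E) ->
   {ae P, forall w, hausdorff_cvg (set_average (fun n => X n w : set E)) C}).
Proof.
have fisher := fisher_cvg_ae P_complete U_neq0 U_separable
  (fun n => (X_random n).1) X_in_U X_independent X_identically_distributed
  X_compact (X_expectation 0%N) (convex_setP C_convex).
split => // C_compact; apply: filterS fisher => w.
by apply: fisher_cvg_compact => //; exact: cbset_neq0.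
Qed.
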